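(* Let $r>0$, and let $\eta_0>0$ be such that for every $t\in[0,1]$ and every $\eta\in\mathbb{C}$ with $|\eta|\le \eta_0$ the fiber $f_t^{-1}(\eta)$ and the sphere $S_r^{2n-1}$ intersect transversely. Then: (1) There exists an isotopy $h_t:S_r^{2n-1}\to S_r^{2n-1}$, $0\le t\le 1$, such that $h_0=\mathrm{id}$, such that $f_t(h_t(\mathbf z))=f_0(\mathbf z)$ for every $t\in[0,1]$ and every $\mathbf z\in S_r^{2n-1}$ with $|f_0(\mathbf z)|\le\eta_0$, and such that $h_t(K_0)=K_t$ for each $0\le t\le 1$. (2) The Milnor fibrations of $f_{\mathbf a,\mathbf b}$ and $f_{\mathbf a}$ by the second description are $C^\infty$ equivalent: for every $t\in[0,1]$ (in particular for $t=1$) the fibrations $$f_0:\partial E_0(\eta_0,r)\to S^1_{\eta_0},\qquad f_t:\partial E_t(\eta_0,r)\to S^1_{\eta_0}$$ are $C^\infty$ equivalent.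
   Context: Let $n\ge 1$, and let $\mathbf a=(a_1,\dots,a_n)$, $\mathbf b=(b_1,\dots,b_n)$ be integer vectors with $a_j>0$ and $b_j\ge 0$ for all $j$. Define functions $\mathbb{C}^n\to\mathbb{C}$ by $$f_{\mathbf a,\mathbf b}(\mathbf z,\bar{\mathbf z})=\sum_{j=1}^n z_j^{a_j+b_j}\bar z_j^{b_j},\qquad f_{\mathbf a}(\mathbf z)=\sum_{j=1}^n z_j^{a_j},$$ and, for $0\le t\le 1$, $$f_t(\mathbf z,\bar{\mathbf z})=(1-t)f_{\mathbf a,\mathbf b}(\mathbf z,\bar{\mathbf z})+t f_{\mathbf a}(\mathbf z)=\sum_{j=1}^n z_j^{a_j}\bigl(t+(1-t)|z_j|^{2b_j}\bigr),$$ so $f_0=f_{\mathbf a,\mathbf b}$ and $f_1=f_{\mathbf a}$; write $f_t(\mathbf z)$ for $f_t(\mathbf z,\bar{\mathbf z})$. Put $V_t=f_t^{-1}(0)$, $S_r^{2n-1}=\{\mathbf z\in\mathbb{C}^n: \|\mathbf z\|=r\}$, $K_t=V_t\cap S_r^{2n-1}$, $S^1_{\eta_0}=\{\eta\in\mathbb{C}:|\eta|=\eta_0\}$, and $$\partial E_t(\eta_0,r)=\{\mathbf z\in\mathbb{C}^n : |f_t(\mathbf z)|=\eta_0,\ \|\mathbf z\|\le r\}.$$ An isotopy means a family of diffeomorphisms depending smoothly on $t\in[0,1]$. Two fibrations $p:E\to B$, $p':E'\to B$ are $C^\infty$ equivalent if there is a diffeomorphism $\Phi:E\to E'$ (of manifolds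 with boundary) with $p'\circ\Phi=p$. *)

(* Defs.v *)
From HB Require Import structures.
From mathcomp Require Import all_boot all_order all_algebra.
From mathcomp Require Import all_classical all_reals all_analysis.
From mathcomp Require Import complex.
Set Implicit Arguments.
Unset Strict Implicit.
Unset Printing Implicit Defensive.
Import Order.TTheory GRing.Theory Num.Theory.
Import numFieldNormedType.Exports.
Local Open Scope classical_set_scope.
Local Open Scope ring_scope.
Local Open Scope complex_scope.

(** * Smooth maps on subsets of finite-dimensional real normed spaces *)

Section Smooth.
Variable R : realType.
Implicit Types V W : normedModType R.

(* [contdiff k U g]: g is C^k on the open set U.  In finite dimension, g is
   C^(k+1) iff all its directional derivatives exist and are C^k. *)
Fixpoint contdiff V W (k : nat) (U : set V) (g : V -> W) : Prop :=
  match k with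
  | 0 => forall x, U x -> {for x, continuous g}
  | k'.+1 => forall v : V,
      (forall x, U x -> derivable g x v) /\ contdiff k' U ('D_v g)
  end.

Definition smooth V W (U : set V) (g : V -> W) : Prop :=
  forall k, contdiff k U g.

(* Smoothness on an arbitrary subset A: local extendability to a smooth map on
   an open set.  On an embedded submanifold, possibly with boundary or corners,
   this is the usual notion. *)
Definition smooth_on V W (A : set V) (f : V -> W) : Prop :=
  forall x, A x -> exists U : set V, exists g : V -> W,
    [/\ open U, U x, smooth U g & forall y, A y -> U y -> g y = f y].

Definition diffeomorphism V W (A : set V) (B : set W) (f : V -> W) : Prop :=
  exists g : W -> V,
    [/\ set_fun A B f, set_fun B A g,
        (forall x, A x -> g (f x) = x), (forall y, B y -> f (g y) = y) &
        smooth_on A f /\ smooth_on B g].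

(* Smooth dependence on t is joint smoothness in (t, x) on [0, 1] x M. *)
Definition isotopy V (M : set V) (h : R -> V -> V) : Prop :=
  (forall t : R, 0 <= t <= 1 -> diffeomorphism M M (h t)) /\
  smooth_on [set p : R * V | 0 <= p.1 <= 1 /\ M p.2] (fun p => h p.1 p.2).

Definition Cinfty_equivalent V W (T : Type) (E : set V) (E' : set W)
    (B : set T) (p : V -> T) (p' : W -> T) : Prop :=
  [/\ set_fun E B p, set_fun E' B p' &
      exists Phi : V -> W,
        diffeomorphism E E' Phi /\ forall z, E z -> p' (Phi z) = p z].

(* Velocities at z of smooth curves lying in M; this is the tangent space
   T_z M wherever M is an embedded submanifold near z. *)
Definition tangent V (M : set V) (z : V) : set V :=
  [set v | exists e : R, exists c : R -> V,
     [/\ 0 < e, smooth `]- e, e[ c, (forall s : R, - e < s < e -> M (c s)),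
         c 0 = z & derive1 c 0 = v]].

(* M and N are assumed to be submanifolds near each point of M `&` N; for
   the fibers and spheres below this holds because f_t is a submersion away
   from the origin. *)
Definition transverse V (M N : set V) : Prop :=
  forall z, M z -> N z -> forall v,
    exists2 u, tangent M z u & exists2 w, tangent N z w & v = u + w.

End Smooth.

(** * The mixed polynomials *)

(* C^n with its real structure: the real parts of the n complex coordinates,
   followed by their imaginary parts. *)
Definition cspace (R : realType) (n : nat) : normedModType R :=
  'rV[R]_(n + n).

Section Mixed.
Variables (R : realType) (n : nat).

Definition ccoord (z : cspace R n) (j : 'I_n) : R[i] :=
  z ord0 (lshift n j) +i* z ord0 (rshift n j).

(* The library norm of row vectors is the sup norm. *)
Definition enorm (z : cspace R n) : R :=
  Num.sqrt (\sum_(k < n + n) z ord0 k ^+ 2).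

Definition sphere (r : R) : set (cspace R n) := [set z | enorm z = r].

Variables a b : 'I_n -> nat.

Definition f_ab (z : cspace R n) : R[i] :=
  \sum_(j < n) ccoord z j ^+ (a j + b j) * (ccoord z j)^* ^+ b j.

Definition f_a (z : cspace R n) : R[i] := \sum_(j < n) ccoord z j ^+ a j.

Definition f_ (t : R) (z : cspace R n) : R[i] :=
  (1 - t)%:C * f_ab z + t%:C * f_a z.

Definition fiber (t : R) (eta : R[i]) : set (cspace R n) :=
  [set z | f_ t z = eta].

Definition link (r t : R) : set (cspace R n) := fiber t 0 `&` sphere r.

Definition tube (eta0 r t : R) : set (cspace R n) :=
  [set z | `|f_ t z| = eta0%:C /\ enorm z <= r].

End Mixed.

Definition circle (R : realType) (eta0 : R) : set R[i] :=
  [set eta | `|eta| = eta0%:C].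

(* Main.v *)
Require Import Defs.
From HB Require Import structures.
From mathcomp Require Import all_boot all_order all_algebra.
From mathcomp Require Import all_classical all_reals all_analysis.
From mathcomp Require Import complex.
From mathcomp Require Import ring lra.
Set Implicit Arguments.
Unset Strict Implicit.
Unset Printing Implicit Defensive.
Import Order.TTheory GRing.Theory Num.Theory.
Import numFieldNormedType.Exports.
Local Open Scope classical_set_scope.
Local Open Scope ring_scope.

(** The isotopy is the flow of a time-dependent vector field [v (t, z)] that moves
    the fibers of [f_t] onto each other: [df_t (v) = - (d/dt) f_t], so that
    [f_t (z (t))] is constant along trajectories, and [v] is tangent to the sphere
    of radius [r].  Both assertions come from one and the same field.

    Let [u1, u2] be the gradients in [z] of the real and imaginary parts of
    [f_t].  The first requirement is solved in the span of [u1, u2] by dividing by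
    their Gram determinant; the solution is corrected by a multiple of the
    component [perp] of the position vector [z] orthogonal to [u1, u2].  With
    [mu = r^2 - |z|^2] the correction is chosen such that [<z, v>] is a multiple of
    [mu] ([dot_lift3]).  Hence [mu] solves a homogeneous linear differential
    equation along trajectories and keeps its sign: the closed ball and the sphere
    are invariant ([depth_flow]).  After clearing denominators the field is a
    smooth vector field divided by [den], a smooth function that is positive as
    soon as [u1, u2] are independent and either [mu > 0] or [perp] is nonzero
    ([lift_den_gt0]).

    Off the origin [u1, u2] are independent, because already one nonzero
    coordinate moves [z^a (t + (1 - t) |z|^2b)] radially and angularly
    ([gramdet_deformation_gt0]); on the sphere, over [|eta| <= eta0], transversality
    is what makes [perp] nonzero ([transverse_perp]).  So [den] has a positive lower
    bound on the compact set [region] of the [(t, z)] with [0 <= t <= 1] that lie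
    over [|eta| = eta0] in the ball, or over [|eta| <= eta0] on the sphere.  Below
    this bound [1 / den] is replaced by a smooth positive function, and the field is
    cut off far from [0 <= t <= 1] and the ball; it becomes smooth on the whole
    space with compact support.  A trajectory that starts in [region] cannot leave
    it: as long as [den] stays above the bound the value of [f_t] is unchanged,
    hence the trajectory is still in [region], where [den] is strictly larger
    ([flow_conserves]).

    What remains is the smooth dependence of the flow on time and initial point
    ([flow_Cinf]).  Trajectories exist by Picard iteration in a weighted norm
    ([picard_lindelof]).  The derivative of the flow solves the linearized equation
    ([is_derive_flow_init]), and together with the flow it is the flow of the
    tangent field on the doubled space; so continuity of flows, applied to iterated
    tangent fields, yields all higher derivatives. *)

(** * Directional derivatives *)

Section DirectionalDerivatives.
Variable R : realType.
Implicit Types V W X : normedModType R.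

(** Both difference quotients are the same function of [h]. *)
Lemma is_derive_along V (V' : normedModType R) W (f : V -> W) (g : V' -> W) x v y w d :
  (forall h : R, f (h *: v + x) = g (h *: w + y)) ->
  is_derive y w g d -> is_derive x v f d.
Proof.
move=> fg [gy gd].
have fxy : f x = g y by have := fg 0; rewrite !scale0r !add0r.
have E : (fun h : R => h^-1 *: ((f \o shift x) (h *: v) - f x)) =
         (fun h : R => h^-1 *: ((g \o shift y) (h *: w) - g y)).
  by apply/funext => h /=; rewrite fg fxy.
by split; rewrite /derivable /derive E.
Qed.

Lemma is_derive_affine V W X (g : W -> X) (A : V -> W) x v w d :
  (forall h : R, A (h *: v + x) = h *: w + A x) ->
  is_derive (A x) w g d -> is_derive x v (g \o A) d.
Proof. by move=> Axv; apply: is_derive_along => h /=; rewrite Axv. Qed.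

Lemma is_deriveZdir V W (f : V -> W) x v d (s : R) :
  is_derive x v f d -> is_derive x (s *: v) f (s *: d).
Proof.
move=> fx.
pose g (h : R) := f (h *: v + x).
have g0 : differentiable g 0.
  by apply/derivable1_diffP/(derivable1P f x v); case: fx.
have dg t : is_derive x (t *: v) f ('D_t g 0).
  have E : (fun h : R => h^-1 *: ((f \o shift x) (h *: (t *: v)) - f x)) =
           (fun h : R => h^-1 *: ((g \o shift 0) (h *: t) - g 0)).
    by apply/funext => h; rewrite /= /g addr0 scale0r add0r scalerA.
  split; last by rewrite /derive E.
  by rewrite /derivable E; exact: diff_derivable.
have d1 : 'D_1 g 0 = d.
  by have [_ <-] := dg 1; rewrite scale1r; exact: derive_val.
have ds : 'D_s g 0 = s *: d.
  rewrite deriveE// -[s in LHS](mulr1 s) -[s * 1]/(s *: 1) linearZ.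
  by rewrite -deriveE// d1.
by rewrite -ds; exact: dg.
Qed.

(** Derivability along [v] alone is enough: this is what gives access to the
    additivity of directional derivatives before [f] is known to be
    differentiable. *)
Lemma derive_MVT V (f : V -> R) x v : (forall y, derivable f y v) ->
  exists2 th : R, 0 <= th <= 1 & f (v + x) - f x = 'D_v f (th *: v + x).
Proof.
move=> df; pose g (s : R) := f (s *: v + x).
have dg (s : R) : is_derive s 1 g ('D_v f (s *: v + x)).
  apply: (@is_derive_affine _ _ _ f (fun s : R => s *: v + x) s 1 v).
    by move=> h; rewrite scalerDl -addrA [h%:A]mulr1.
  exact/derivableP.
have [|c c01] := @MVT_segment _ g _ 0 1 ler01 (fun s _ => dg s).
  apply: continuous_subspaceT => s.
  exact/differentiable_continuous/derivable1_diffP.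
rewrite /g scale1r scale0r add0r subr0 mulr1 => ->.
by exists c; rewrite //; move: c01; rewrite in_itv.
Qed.

(** The increment along [u + v] is an increment along [u] followed by one along [v]
    from a moving base point; the mean value theorem and the continuity of
    ['D_v f] absorb the motion of the base point. *)
Lemma is_deriveDdir V (f : V -> R) x u v a :
  is_derive x u f a -> (forall y, derivable f y v) ->
  {for x, continuous ('D_v f)} ->
  is_derive x (u + v) f (a + 'D_v f x).
Proof.
move=> fu fv cfv.
have Q (s : R) : exists2 th : R, 0 <= th <= 1 &
    f (s *: v + (s *: u + x)) - f (s *: u + x) =
    s *: 'D_v f (th *: (s *: v) + (s *: u + x)).
  have [y|th th01 ->] := @derive_MVT _ f (s *: u + x) (s *: v).
    by case: (is_deriveZdir s (derivableP (fv y))).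
  exists th => //.
  by case: (is_deriveZdir s (derivableP (fv (th *: (s *: v) + (s *: u + x))))).
pose th s := s2val (cid2 (Q s)).
have th01 s : `|th s| <= 1.
  by rewrite /th; case: (cid2 (Q s)) => t /= /andP[t0 t1] _; rewrite ger0_norm.
have thE s : f (s *: v + (s *: u + x)) - f (s *: u + x) =
    s *: 'D_v f (th s *: (s *: v) + (s *: u + x)).
  by rewrite /th; case: (cid2 (Q s)).
have xi : th s *: (s *: v) + (s *: u + x) @[s --> 0^'] --> x.
  rewrite -[X in _ --> X]add0r; apply: cvgD; last first.
    rewrite -[X in _ --> X]add0r; apply: cvgD; last exact: cvg_cst.
    rewrite -(scale0r u); apply: cvgZr_tmp; apply: cvg_within_filter.
    exact: cvg_id.
  apply/cvgr0Pnorm_lt => e e0.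
  near=> s; rewrite normrZ (@le_lt_trans _ _ `|s *: v|)//.
    by rewrite ler_piMl.
  near: s.
  have : s *: v @[s --> 0^'] --> (0 : V).
    rewrite -(scale0r v); apply: cvgZr_tmp; apply: cvg_within_filter.
    exact: cvg_id.
  by move/cvgr0Pnorm_lt => /(_ _ e0).
have E : \forall s \near 0^', s^-1 *: ((f \o shift x) (s *: u) - f x) +
    'D_v f (th s *: (s *: v) + (s *: u + x)) =
    s^-1 *: ((f \o shift x) (s *: (u + v)) - f x).
  near=> s; have s0 : s != 0 by near: s; exact: nbhs_dnbhs_neq.
  rewrite /= -[X in _ + X]scale1r -(mulVf s0) -scalerA -thE -scalerDr.
  have -> : s *: (u + v) + x = s *: v + (s *: u + x).
    by rewrite addrA -scalerDr [v + u]addrC.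
  by rewrite [in LHS]addrC subrKA.
have C : s^-1 *: ((f \o shift x) (s *: (u + v)) - f x) @[s --> 0^'] -->
    a + 'D_v f x.
  apply: cvg_trans (_ : s^-1 *: ((f \o shift x) (s *: u) - f x) +
    'D_v f (th s *: (s *: v) + (s *: u + x)) @[s --> 0^'] --> _).
    exact: near_eq_cvg.
  apply: cvgD; first by have [h <-] := fu; exact: h.
  exact: (cvg_comp _ _ xi cfv).
split; first by apply/cvg_ex; eexists; exact: C.
exact: cvg_lim C.
Unshelve. all: by end_near. Qed.

End DirectionalDerivatives.

(** * The classes C^k and their closure properties *)

Section Ck.
Variable R : realType.
Implicit Types V W X : normedModType R.

(** Including continuity at every order makes the class decreasing in [k] by
    construction. *)
Definition Ck V W : nat -> (V -> W) -> Prop :=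
  fix Ck k (g : V -> W) := match k with
  | 0 => continuous g
  | k'.+1 => continuous g /\
      forall v, (forall x, derivable g x v) /\ Ck k' ('D_v g)
  end.

Definition Cinf V W (g : V -> W) := forall k, Ck k g.

Lemma Ck_continuous V W k (g : V -> W) : Ck k g -> continuous g.
Proof. by case: k => [|k] //= []. Qed.

Lemma Ck_contdiff V W k (g : V -> W) : Ck k g -> contdiff k setT g.
Proof.
elim: k g => [|k IH] g /=; first by move=> cg x _; exact: cg.
by move=> [_ cg] v; have [dg Dg] := cg v; split; [move=> x _|exact: IH].
Qed.

Lemma Cinf_smooth V W (g : V -> W) : Cinf g -> smooth setT g.
Proof. by move=> cg k; exact/Ck_contdiff. Qed.

Lemma CkW V W k (g : V -> W) : Ck k.+1 g -> Ck k g.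
Proof.
elim: k g => [|k IH] g; first by case.
by move=> [cg dg]; split=> // v; have [? ?] := dg v; split=> //; exact: IH.
Qed.

Lemma Ck_cst V W k (c : W) : Ck k (fun _ : V => c).
Proof.
elim: k c => [|k IH] c; first by move=> x; exact: cvg_cst.
split; [by move=> x; exact: cvg_cst|move=> v].
split=> [x|]; first exact: derivable_cst.
rewrite (_ : 'D_v _ = (fun _ => 0)) //; apply/funext => x; exact: derive_cst.
Qed.

Lemma CkD V W k (f g : V -> W) : Ck k f -> Ck k g -> Ck k (fun x => f x + g x).
Proof.
elim: k f g => [|k IH] f g; first by move=> cf cg x; apply: cvgD; [exact: cf|exact: cg].
move=> [cf df] [cg dg]; split; first by move=> x; apply: cvgD; [exact: cf|exact: cg].
move=> v; have [dfv Dfv] := df v; have [dgv Dgv] := dg v.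
split=> [x|]; first exact: derivableD.
rewrite (_ : 'D_v _ = (fun x => 'D_v f x + 'D_v g x)); first exact: IH.
by apply/funext => x; rewrite deriveD.
Qed.

Lemma CkM V k (f g : V -> R) : Ck k f -> Ck k g -> Ck k (fun x => f x * g x).
Proof.
elim: k f g => [|k IH] f g; first by move=> cf cg x; apply: cvgM; [exact: cf|exact: cg].
move=> Ckf Ckg; have [cf df] := Ckf; have [cg dg] := Ckg.
split; first by move=> x; apply: cvgM; [exact: cf|exact: cg].
move=> v; have [dfv Dfv] := df v; have [dgv Dgv] := dg v.
split=> [x|]; first exact: derivableM.
rewrite (_ : 'D_v _ = (fun x => f x * 'D_v g x + g x * 'D_v f x)).
  by apply: CkD; apply: IH => //; exact: CkW.
by apply/funext => x; rewrite deriveM.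
Qed.

Lemma CkN V k (f : V -> R) : Ck k f -> Ck k (fun x => - f x).
Proof.
move=> cf; rewrite (_ : (fun _ => _) = (fun x => (-1) * f x)).
  by apply: CkM => //; exact: Ck_cst.
by apply/funext => x; rewrite mulN1r.
Qed.

Lemma CkB V k (f g : V -> R) : Ck k f -> Ck k g -> Ck k (fun x => f x - g x).
Proof. by move=> cf cg; apply: CkD => //; exact: CkN. Qed.

Lemma Ck_sum V k (I : Type) (s : seq I) (f : I -> V -> R) :
  (forall i, Ck k (f i)) -> Ck k (fun x => \sum_(i <- s) f i x).
Proof.
move=> cf; elim: s => [|i s IH].
  rewrite (_ : (fun _ => _) = (fun _ => 0)); first exact: Ck_cst.
  by apply/funext => x; rewrite big_nil.
rewrite (_ : (fun _ => _) = (fun x => f i x + \sum_(i <- s) f i x)).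
  exact: CkD.
by apply/funext => x; rewrite big_cons.
Qed.

Lemma CkX V k (f : V -> R) n : Ck k f -> Ck k (fun x => f x ^+ n).
Proof.
move=> cf; elim: n => [|n IH].
  by rewrite (_ : (fun _ => _) = (fun _ => 1)); first exact: Ck_cst.
rewrite (_ : (fun _ => _) = (fun x => f x * f x ^+ n)); first exact: CkM.
by apply/funext => x; rewrite exprS.
Qed.

Lemma CkV V k (f : V -> R) : (forall x, f x != 0) -> Ck k f ->
  Ck k (fun x => (f x)^-1).
Proof.
move=> f0; elim: k f f0 => [|k IH] f f0.
  by move=> cf x; apply: cvgV; [exact: f0|exact: cf].
move=> Ckf; have [cf df] := Ckf; split.
  by move=> x; apply: cvgV; [exact: f0|exact: cf].
move=> v; have [dfv Dfv] := df v; split=> [x|]; first exact: derivableV.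
rewrite (_ : 'D_v _ = (fun x => - ((f x)^-1 ^+ 2 * 'D_v f x))).
  by apply/CkN/CkM => //; apply/CkX/IH => //; exact: CkW.
by apply/funext => x; rewrite deriveV// scaleNr exprVn.
Qed.

(** Along every line [A] is affine with direction given by [B], hence
    directional derivatives along [v] are transported to those along [B v]. *)
Lemma Ck_affine V W X k (g : W -> X) (A B : V -> W) :
  continuous A -> (forall x v (h : R), A (h *: v + x) = h *: B v + A x) ->
  Ck k g -> Ck k (fun x => g (A x)).
Proof.
move=> cA AB.
have dgA (f : W -> X) x v : derivable f (A x) (B v) ->
    is_derive x v (f \o A) ('D_(B v) f (A x)).
  move=> df; apply: (@is_derive_affine _ _ _ _ f A x v (B v)); last exact: derivableP.
  by move=> h; exact: AB.
elim: k g => [|k IH] g; first by move=> cg x; apply: continuous_comp; [exact: cA|exact: cg].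
move=> [cg dg]; split.
  by move=> x; apply: continuous_comp; [exact: cA|exact: cg].
move=> v; have [dgv Dgv] := dg (B v).
split=> [x|]; first by case: (dgA g x v (dgv _)).
rewrite (_ : 'D_v _ = (fun x => 'D_(B v) g (A x))).
  exact: (IH ('D_(B v) g)).
by apply/funext => x; case: (dgA g x v (dgv _)).
Qed.

Lemma continuous_rV V m (g : V -> 'rV[R]_m) :
  (forall j, continuous (fun x => g x ord0 j)) -> continuous g.
Proof.
move=> cg x; apply/cvgrPdist_lt => e e0; near=> y.
rewrite [ltLHS]/Num.Def.normr/= mx_normrE.
apply: bigmax_lt => //= -[i j] _; rewrite !mxE ord1 /= {i}.
move: j; near: y; apply: filter_forall => j.
by have /cvgrPdist_lt := cg j x; apply.
Unshelve. all: by end_near. Qed.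

Lemma Ck_rV V k m (g : V -> 'rV[R]_m) :
  (forall j, Ck k (fun x => g x ord0 j)) -> Ck k g.
Proof.
elim: k g => [|k IH] g cg; first exact: continuous_rV.
have C0 : continuous g by apply: continuous_rV => j; exact: (cg j).1.
split=> // v.
have D x : derivable g x v.
  by apply/derivable_mxP => i j; rewrite ord1; exact: ((cg j).2 v).1.
split=> //; apply: IH => j.
rewrite (_ : (fun _ => _) = 'D_v (fun x => g x ord0 j)).
  exact: ((cg j).2 v).2.
by apply/funext => x; rewrite derive_mx// mxE.
Qed.

Lemma Ck_coord V k m (g : V -> 'rV[R]_m) j :
  Ck k g -> Ck k (fun x => g x ord0 j).
Proof.
have cc (f : V -> 'rV[R]_m) : continuous f -> continuous (fun x => f x ord0 j).
  move=> cf x; apply: (@continuous_comp _ _ _ f (fun y : 'rV[R]_m => y ord0 j)).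
    exact: cf.
  exact: coord_continuous.
elim: k g => [|k IH] g; first exact: cc.
move=> [cg dg]; split; first exact: cc.
move=> v; have [dgv Dgv] := dg v; split=> [x|].
  by have /derivable_mxP := dgv x; apply.
rewrite (_ : 'D_v _ = (fun x => 'D_v g x ord0 j)); first exact: IH.
by apply/funext => x; rewrite derive_mx// mxE.
Qed.

Lemma Ck_id m k : Ck k (@id 'rV[R]_m).
Proof.
apply: Ck_rV => j; elim: k => [|k _]; first exact: coord_continuous.
have D (x v : 'rV[R]_m) : is_derive x v (fun y : 'rV[R]_m => y ord0 j) (v ord0 j).
  have dx : derivable (@id 'rV[R]_m) x v by exact: derivable_id.
  split; first by move/derivable_mxP: dx; apply.
  by have := derive_mx dx; rewrite derive_id => /matrixP/(_ ord0 j); rewrite mxE.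
split; first exact: coord_continuous.
move=> v; split=> [x|]; first by case: (D x v).
rewrite (_ : 'D_v _ = (fun _ => v ord0 j)); first exact: Ck_cst.
by apply/funext => x; case: (D x v).
Qed.

End Ck.

(** * Mean values, the chain rule and estimates on balls *)

Section Partial.
Variable R : realType.
Implicit Types V : normedModType R.

Definition partial m (f : 'rV[R]_m -> R) (j : 'I_m) : 'rV[R]_m -> R :=
  'D_(delta_mx ord0 j) f.

Lemma Ck_partial m k (f : 'rV[R]_m -> R) j : Ck k.+1 f -> Ck k (partial f j).
Proof. by case=> _ /(_ (delta_mx ord0 j)) []. Qed.

(** The direction is decomposed on the canonical basis and the terms are added one
    by one with [is_deriveDdir]. *)
Lemma is_derive_partial m (f : 'rV[R]_m -> R) x v : Ck 1 f ->
  is_derive x v f (\sum_j v ord0 j * partial f j x).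
Proof.
move=> [cf df].
have df' w y : derivable f y w by have [] := df w.
rewrite {1}[v]row_sum_delta.
elim: (index_enum 'I_m) => [|j s IH].
  by rewrite !big_nil; exact: is_derive0.
have D y : is_derive y (v ord0 j *: delta_mx ord0 j) f
                     (v ord0 j * partial f j y).
  by apply: is_deriveZdir; exact/derivableP.
have E : 'D_(v ord0 j *: delta_mx ord0 j) f = (fun y => v ord0 j * partial f j y).
  by apply/funext => y; case: (D y).
rewrite !big_cons addrC [X in is_derive _ _ _ X]addrC.
have := is_deriveDdir IH (df' (v ord0 j *: delta_mx ord0 j)).
case: (D x) => _ <-; apply.
by have [_ c] := df (v ord0 j *: delta_mx ord0 j); exact: c.
Qed.

Lemma mean_value m (f : 'rV[R]_m -> R) x y : Ck 1 f ->
  exists2 th : R, 0 <= th <= 1 & f y - f x =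
    \sum_j (y - x) ord0 j * partial f j (th *: (y - x) + x).
Proof.
move=> cf; have df w z : derivable f z w by case: cf => _ /(_ w) [].
have [th th01 E] := derive_MVT x (df (y - x)).
exists th => //; rewrite -[y in f y](subrK x) E.
by case: (is_derive_partial (th *: (y - x) + x) (y - x) cf).
Qed.

(** By the mean value theorem the difference quotient of [f \o g] is the sum of
    those of the coordinates of [g], weighted by partial derivatives of [f] at a
    point that converges to [g x]. *)
Lemma is_derive_comp_rV V m (f : 'rV[R]_m -> R) (g : V -> 'rV[R]_m) x v :
  Ck 1 f -> derivable g x v ->
  is_derive x v (f \o g) (\sum_j 'D_v g x ord0 j * partial f j (g x)).
Proof.
move=> cf dg.
have Q (s : R) : exists2 th : R, 0 <= th <= 1 &
    f (g (s *: v + x)) - f (g x) = \sum_j (g (s *: v + x) - g x) ord0 j *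
      partial f j (th *: (g (s *: v + x) - g x) + g x).
  exact: mean_value.
pose th s := s2val (cid2 (Q s)).
have th01 s : `|th s| <= 1.
  by rewrite /th; case: (cid2 (Q s)) => t /= /andP[t0 t1] _; rewrite ger0_norm.
have thE s : f (g (s *: v + x)) - f (g x) =
    \sum_j (g (s *: v + x) - g x) ord0 j *
      partial f j (th s *: (g (s *: v + x) - g x) + g x).
  by rewrite /th; case: (cid2 (Q s)).
have gs : g (s *: v + x) - g x @[s --> 0^'] --> (0 : 'rV[R]_m).
  have dg0 : s^-1 *: (g (s *: v + x) - g x) @[s --> 0^'] --> 'D_v g x by exact: dg.
  rewrite -(scale0r ('D_v g x)).
  apply: cvg_trans (_ : s *: (s^-1 *: (g (s *: v + x) - g x)) @[s --> 0^'] --> _).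
    apply: near_eq_cvg; near=> s; rewrite scalerA mulfV ?scale1r//.
    by near: s; exact: nbhs_dnbhs_neq.
  by apply: cvgZ dg0; apply: cvg_within_filter; exact: cvg_id.
have xi : th s *: (g (s *: v + x) - g x) + g x @[s --> 0^'] --> g x.
  rewrite -[X in _ --> X]add0r; apply: cvgD; last exact: cvg_cst.
  apply/cvgr0Pnorm_lt => e e0; near=> s; rewrite normrZ.
  apply: (@le_lt_trans _ _ `|g (s *: v + x) - g x|); first by rewrite ler_piMl.
  by near: s; move/cvgr0Pnorm_lt : gs => /(_ _ e0).
have C : s^-1 *: (f (g (s *: v + x)) - f (g x)) @[s --> 0^'] -->
    \sum_j 'D_v g x ord0 j * partial f j (g x).
  under eq_fun => s do rewrite thE scaler_sumr.
  apply: cvg_big => [|j _]; first exact: add_continuous.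
  under eq_fun => s do rewrite scalerAl.
  apply: cvgM; last first.
    have cp : continuous (partial f j) by exact: (Ck_partial j cf).
    exact: (cvg_comp _ _ xi (cp (g x))).
  have dg0 : s^-1 *: (g (s *: v + x) - g x) @[s --> 0^'] --> 'D_v g x by exact: dg.
  have := cvg_comp _ _ dg0 (@coord_continuous _ _ _ ord0 j ('D_v g x)).
  by apply: cvg_trans; apply: near_eq_cvg; near=> s; rewrite /= !mxE.
split; first by apply/cvg_ex; eexists; exact: C.
exact: cvg_lim C.
Unshelve. all: by end_near. Qed.

Lemma Ck_comp V m k (f : 'rV[R]_m -> R) (g : V -> 'rV[R]_m) :
  Cinf f -> Ck k g -> Ck k (fun x => f (g x)).
Proof.
elim: k f => [|k IH] f cf.
  by move=> cg x; apply: continuous_comp; [exact: cg|exact: (cf 0)].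
move=> Ckg; have [cg dg] := Ckg; split.
  by move=> x; apply: continuous_comp; [exact: cg|exact: (cf 0)].
move=> v; have [dgv Dgv] := dg v.
split=> [x|]; first by case: (is_derive_comp_rV (cf 1) (dgv x)).
rewrite (_ : 'D_v _ = (fun x => \sum_j 'D_v g x ord0 j * partial f j (g x))).
  apply: Ck_sum => j; apply: CkM; first exact: Ck_coord.
  by apply: IH (CkW Ckg) => i; exact: Ck_partial.
by apply/funext => x; case: (is_derive_comp_rV (cf 1) (dgv x)).
Qed.

Lemma compact_ball m (rho : R) : compact [set x : 'rV[R]_m | `|x| <= rho].
Proof.
apply: bounded_closed_compact.
  exists rho; split; first exact: num_real.
  by move=> y ry x /le_trans; apply; exact: ltW.
rewrite (_ : [set _ | _] = (fun x : 'rV[R]_m => `|x|) @^-1` [set y : R | y <= rho])//.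
by apply: closed_comp; [move=> x _; exact: norm_continuous|exact: closed_le].
Qed.

Lemma bounded_on_ball m (f : 'rV[R]_m -> R) (rho : R) : continuous f ->
  exists2 M : R, 0 <= M & forall x, `|x| <= rho -> `|f x| <= M.
Proof.
move=> cf; have [rho0|rho0] := ltP rho 0.
  by exists 0 => // x /(le_trans (normr_ge0 x)); rewrite leNgt rho0.
have A0 : [set x : 'rV[R]_m | `|x| <= rho] !=set0 by exists 0; rewrite /= normr0.
have [|c cA' cM] := @EVT_max_rV R m (fun x => `|f x|) _ A0 (@compact_ball m rho).
  apply: continuous_subspaceT => x; apply: (continuous_comp (cf x)).
  exact: norm_continuous.
by exists `|f c| => // x Ax; apply: cM; rewrite inE.
Qed.

Lemma normr_coord m (x : 'rV[R]_m) j : `|x ord0 j| <= `|x|.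
Proof.
rewrite [leRHS]/Num.Def.normr/= mx_normrE.
exact: (le_bigmax _ (fun i : 'I_1 * 'I_m => `|x i.1 i.2|) (ord0, j)).
Qed.

Lemma normr_rV_le m (x : 'rV[R]_m) (c : R) :
  0 <= c -> (forall j, `|x ord0 j| <= c) -> `|x| <= c.
Proof.
move=> c0 xc; rewrite [leLHS]/Num.Def.normr/= mx_normrE.
by apply: bigmax_le => //= -[i j] _; rewrite ord1.
Qed.

Lemma normr_sum_coord m (x : 'rV[R]_m) (c : 'I_m -> R) (M : R) :
  (forall j, `|c j| <= M) -> `|\sum_j x ord0 j * c j| <= m%:R * M * `|x|.
Proof.
move=> cM; apply: (le_trans (ler_norm_sum _ _ _)).
apply: (@le_trans _ _ (\sum_(j < m) M * `|x|)).
  apply: ler_sum => j _; rewrite normrM mulrC ler_pM//; exact: normr_coord.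
by rewrite sumr_const card_ord -[leLHS]mulr_natl mulrA.
Qed.

Lemma segment_ball m (x y : 'rV[R]_m) (th rho : R) : 0 <= th <= 1 ->
  `|x| <= rho -> `|y| <= rho -> `|th *: (y - x) + x| <= rho.
Proof.
move=> /andP[t0 t1] xr yr.
have -> : th *: (y - x) + x = th *: y + (1 - th) *: x.
  by rewrite scalerBr scalerBl scale1r -addrA [- _ + x]addrC.
apply: (le_trans (ler_normD _ _)); rewrite !normrZ !ger0_norm ?subr_ge0//.
by apply: (@le_trans _ _ (th * rho + (1 - th) * rho));
  [rewrite lerD// ler_wpM2l// subr_ge0|rewrite -mulrDl subrKC mul1r].
Qed.

Lemma lipschitz_on_ball m (f : 'rV[R]_m -> R) (rho : R) : Ck 1 f ->
  exists2 L : R, 0 <= L & forall x y, `|x| <= rho -> `|y| <= rho ->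
    `|f y - f x| <= L * `|y - x|.
Proof.
move=> cf.
have B j := @bounded_on_ball _ (partial f j) rho (Ck_partial j cf).
pose M j := s2val (cid2 (B j)).
have M0 j : 0 <= M j by rewrite /M; case: (cid2 (B j)).
have MB j x : `|x| <= rho -> `|partial f j x| <= M j.
  by rewrite /M; case: (cid2 (B j)) => ? /= _; apply.
exists (m%:R * \sum_j M j); first by rewrite mulr_ge0// sumr_ge0.
move=> x y xr yr; have [th th01 ->] := mean_value x y cf.
apply: normr_sum_coord => j.
apply: (le_trans (MB _ _ (segment_ball th01 xr yr))).
by rewrite (bigD1 j)//= lerDl sumr_ge0.
Qed.

(** Mean value theorem, and Lipschitz bounds for the partial derivatives. *)
Lemma taylor_on_ball m (f : 'rV[R]_m -> R) (rho : R) : Ck 2 f ->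
  exists2 M : R, 0 <= M & forall x y, `|x| <= rho -> `|y| <= rho ->
    `|f y - f x - \sum_j (y - x) ord0 j * partial f j x| <= M * `|y - x| ^+ 2.
Proof.
move=> cf.
have B j := @lipschitz_on_ball _ (partial f j) rho (Ck_partial j cf).
pose M j := s2val (cid2 (B j)).
have M0 j : 0 <= M j by rewrite /M; case: (cid2 (B j)).
have MB j x y : `|x| <= rho -> `|y| <= rho ->
    `|partial f j y - partial f j x| <= M j * `|y - x|.
  by rewrite /M; case: (cid2 (B j)) => ? /= _ h xr yr; exact: h.
exists (m%:R * \sum_j M j); first by rewrite mulr_ge0// sumr_ge0.
move=> x y xr yr; have [th th01 ->] := mean_value x y (CkW cf).
rewrite -sumrB; under eq_bigr do rewrite -mulrBr.
have -> : m%:R * (\sum_j M j) * `|y - x| ^+ 2 =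
    m%:R * ((\sum_j M j) * `|y - x|) * `|y - x| by ring.
apply: normr_sum_coord => j.
apply: (le_trans (MB _ _ _ xr (segment_ball th01 xr yr))).
rewrite addrK normrZ; case/andP: (th01) => t0 t1; rewrite ger0_norm//.
apply: (@le_trans _ _ (M j * `|y - x|)); first by rewrite ler_wpM2l// ler_piMl.
by rewrite ler_wpM2r// (bigD1 j)//= lerDl sumr_ge0.
Qed.

End Partial.

(** * A smooth step function *)

Section Step.
Variable R : realType.

Lemma Ck_derive1 k (g g' : R -> R) : (forall x : R, is_derive x 1 g (g' x)) ->
  Ck k g' -> Ck k.+1 g.
Proof.
move=> dg cg'; split=> [x|v].
  apply/differentiable_continuous/derivable1_diffP; by case: (dg x).
have D x : is_derive x v g (v * g' x).
  by have := is_deriveZdir v (dg x); rewrite [v *: 1]mulr1.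
split=> [x|]; first by case: (D x).
rewrite (_ : 'D_v g = (fun x => v * g' x)); last by apply/funext => x; case: (D x).
by apply: CkM => //; exact: Ck_cst.
Qed.

(** The functions [x^-k * exp(-1/x)], extended by zero: a family closed under
    differentiation, up to linear combinations. *)
Definition flat (k : nat) (x : R) : R :=
  if 0 < x then x^-1 ^+ k * expR (- x^-1) else 0.

Lemma flat_le0 k x : x <= 0 -> flat k x = 0.
Proof. by rewrite /flat ltNge => ->. Qed.

Lemma flat_gt0 k x : 0 < x -> 0 < flat k x.
Proof. by move=> x0; rewrite /flat x0 mulr_gt0 ?expR_gt0// exprn_gt0// invr_gt0. Qed.

Lemma flat_ge0 k x : 0 <= flat k x.
Proof. by have [/flat_le0->//|/flat_gt0/ltW] := leP x 0. Qed.

(** For [y = 1 / x] one has [exp y = exp (y / (k+1)) ^ (k+1) >= (y / (k+1)) ^ (k+1)]. *)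
Lemma flat_le_linear k x : `|flat k x| <= k.+1%:R ^+ k.+1 * `|x|.
Proof.
have [x0|x0] := leP x 0; first by rewrite flat_le0// normr0 mulr_ge0// exprn_ge0.
rewrite ger0_norm ?flat_ge0// (gtr0_norm x0) /flat x0.
rewrite expRN ler_pdivrMr ?expR_gt0// -ler_pdivrMl ?mulr_gt0 ?exprn_gt0//.
set y := x^-1; have y0 : 0 < y by rewrite invr_gt0.
have -> : (k.+1%:R ^+ k.+1 * x)^-1 * y ^+ k = (y / k.+1%:R) ^+ k.+1.
  by rewrite invfM expr_div_n [y ^+ k.+1]exprS -/y -mulrA mulrC.
have -> : expR y = expR (y / k.+1%:R) ^+ k.+1.
  by rewrite -expRM_natl mulrC divfK// pnatr_eq0.
apply: lerXn2r; rewrite ?nnegrE ?expR_ge0 ?divr_ge0 ?(ltW y0)//.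
by apply: le_trans (expR_ge1Dx _); rewrite lerDr.
Qed.

Lemma flat_cvg0 k : flat k x @[x --> 0] --> (0 : R).
Proof.
apply/cvgr0Pnorm_lt => e e0; near=> x.
apply: (le_lt_trans (flat_le_linear k x)).
rewrite -ltr_pdivlMl ?exprn_gt0//.
near: x; have := @cvg_id _ (nbhs (0 : R)).
by move/cvgr0Pnorm_lt; apply; rewrite mulr_gt0// invr_gt0 exprn_gt0.
Unshelve. all: by end_near. Qed.

(** At zero the difference quotient is [flat k.+1], which is [O(x)]. *)
Lemma is_derive_flat k (x : R) :
  is_derive x 1 (flat k) (flat k.+2 x - k%:R * flat k.+1 x).
Proof.
have [x0|x0|->] := ltgtP x 0.
- rewrite !flat_le0 ?ltW// mulr0 subr0.
  have := is_derive_cst (0 : R) x (1 : R); apply: near_eq_is_derive.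
  near=> y; rewrite flat_le0// ltW//; near: y; exact: lt_nbhsl.
- suff : is_derive x (1 : R) (fun y => y^-1 ^+ k * expR (- y^-1))
      (flat k.+2 x - k%:R * flat k.+1 x).
    apply: near_eq_is_derive.
    near=> y; rewrite /flat ifT//; near: y; exact: lt_nbhsr.
  have xn0 : x != 0 by rewrite gt_eqF.
  have dV := is_deriveV xn0 (is_derive_id x (1 : R)).
  have dN : is_derive x (1 : R) (fun y : R => - y^-1) (x^-1 ^+ 2).
    apply: (is_derive_eq (is_deriveN dV)).
    by rewrite scaleNr opprK exprVn [_ *: _]mulr1.
  have dE := @is_derive1_comp _ _ (fun y : R => - y^-1) x _ _
    (is_derive_expR (- x^-1)) dN.
  have := is_deriveM (is_deriveX k dV) dE.
  rewrite (_ : _ * _ = (fun y : R => y^-1 ^+ k * expR (- y^-1))); last first.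
    by apply/funext => y; rewrite /= exprfctE.
  move=> D; apply: (is_derive_eq D); rewrite /flat x0.
  rewrite exprfctE /= -exprVn /GRing.scale /= mulr1.
  set y := x^-1; set e := expR _; clear.
  by case: k => [|k] /=; rewrite ?mul0r !exprS; ring.
- rewrite !flat_le0// mulr0 subr0.
  have C : h^-1 *: (flat k (h *: 1 + 0) - flat k 0) @[h --> 0^'] --> (0 : R).
    apply: cvg_trans (_ : flat k.+1 h @[h --> 0^'] --> _).
      apply: near_eq_cvg; near=> h.
      rewrite addr0 [h *: 1]mulr1 (flat_le0 _ (lexx 0)) subr0 /flat.
      case: ifP => h0; last by rewrite scaler0.
      by rewrite exprS -mulrA.
    by apply: cvg_within_filter; exact: flat_cvg0.
  split; first by apply/cvg_ex; eexists; exact: C.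
  exact: cvg_lim C.
Unshelve. all: by end_near. Qed.

Lemma Cinf_flat k : Cinf (flat k).
Proof.
move=> j; elim: j k => [|j IH] k.
  move=> x; apply/differentiable_continuous/derivable1_diffP.
  by case: (is_derive_flat k x).
apply: Ck_derive1 (is_derive_flat k) _.
by apply: CkB => //; apply: CkM => //; exact: Ck_cst.
Qed.

Definition step (x : R) : R := flat 0 x / (flat 0 x + flat 0 (1 - x)).

(** [x] and [1 - x] are not both nonpositive. *)
Lemma step_den x : 0 < flat 0 x + flat 0 (1 - x).
Proof.
have [x0|x0] := ltP 0 x; first by rewrite ltr_wpDr ?flat_ge0 ?flat_gt0.
by rewrite ltr_wpDl ?flat_ge0 ?flat_gt0// subr_gt0 (le_lt_trans x0).
Qed.

Lemma step_le0 x : x <= 0 -> step x = 0.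
Proof. by move=> x0; rewrite /step flat_le0// mul0r. Qed.

Lemma step_ge1 x : 1 <= x -> step x = 1.
Proof.
move=> x1; rewrite /step [flat 0 (1 - x)]flat_le0 ?subr_le0// addr0 divff//.
by rewrite gt_eqF// flat_gt0// (lt_le_trans ltr01).
Qed.

Lemma step_01 x : 0 <= step x <= 1.
Proof.
rewrite divr_ge0 ?flat_ge0 ?(ltW (step_den x))//=.
by rewrite ler_pdivrMr ?step_den// mul1r lerDl flat_ge0.
Qed.

Lemma Cinf_step : Cinf step.
Proof.
move=> k; apply: CkM; first exact: Cinf_flat.
apply: CkV => [x|]; first by rewrite gt_eqF// step_den.
apply: CkD; first exact: Cinf_flat.
apply: (@Ck_affine R R R R k (flat 0) (fun x => 1 - x) -%R _ _ (Cinf_flat 0 k)).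
  by move=> x; apply: cvgB; [exact: cvg_cst|exact: cvg_id].
by move=> x v h; rewrite scalerN opprD addrCA.
Qed.

(** A function of one real variable is seen as a function of one coordinate. *)
Lemma Ck_comp_R (V : normedModType R) k (f : R -> R) (g : V -> R) :
  Cinf f -> Ck k g -> Ck k (fun x => f (g x)).
Proof.
move=> cf cg.
have cF : Cinf (fun y : 'rV[R]_1 => f (y ord0 ord0)).
  move=> j; apply: (@Ck_affine _ _ _ _ j f (fun y : 'rV[R]_1 => y ord0 ord0)
      (fun y => y ord0 ord0) _ _ (cf j)); first exact: coord_continuous.
  by move=> x v h; rewrite !mxE.
have cG : Ck k (fun x => \row_(j < 1) g x : 'rV[R]_1).
  by apply: Ck_rV => j; under eq_fun do rewrite mxE.
have := Ck_comp cF cG.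
by congr (Ck k _); apply/funext => x; rewrite mxE.
Qed.

End Step.

(** * Monotonicity and primitives on the real line *)

Section RealFunctions.
Variable R : realType.

Lemma ger0_derive_le (f f' : R -> R) a b : a <= b ->
  (forall x : R, a <= x <= b -> is_derive x 1 f (f' x)) ->
  (forall x, a <= x <= b -> 0 <= f' x) -> f a <= f b.
Proof.
move=> ab df f'0.
have itvW x : x \in `]a, b[%R -> a <= x <= b.
  by rewrite in_itv /= => /andP[/ltW-> /ltW->].
have [|c + E] := @MVT_segment _ f f' _ _ ab (fun x xab => df x (itvW x xab)).
  apply: derivable_within_continuous => x; rewrite in_itv /= => xab.
  by case: (df x xab).
by rewrite in_itv /= => /f'0 c0; rewrite -subr_ge0 E mulr_ge0// subr_ge0.
Qed.

Lemma eq0_derive_cst (f : R -> R) a b : a <= b ->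
  (forall x : R, a <= x <= b -> is_derive x 1 f 0) -> f a = f b.
Proof.
move=> ab df; apply/eqP; rewrite eq_le; apply/andP; split.
  exact: (@ger0_derive_le f (fun _ => 0)).
rewrite -lerN2; apply: (@ger0_derive_le (- f) (fun _ => 0)) => // x xab.
by apply: (is_derive_eq (is_deriveN (df x xab))); rewrite oppr0.
Qed.

Let F (g : R -> R) (n : nat) (x : R) : R :=
  (\int[@lebesgue_measure R]_(t in `[(- n%:R), x]) g t)%R.

Let is_derive_F (g : R -> R) n (x : R) : continuous g -> - n%:R < x ->
  is_derive x 1 (F g n) (g x).
Proof.
move=> cg nx; have x1 : x < x + 1 by rewrite ltrDl.
have [|] := @continuous_FTC1_closed R g (- n%:R) x (x + 1) x1 _ nx (cg x).
  apply: continuous_compact_integrable; first exact: segment_compact.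
  exact: continuous_subspaceT.
by move=> d e; split; rewrite -?derive1E.
Qed.

(** The integrals from the base points [- n] differ by constants, so that they
    glue to a primitive on the whole line. *)
Lemma continuous_antiderivative (g : R -> R) : continuous g ->
  exists2 G : R -> R, G 0 = 0 & forall x : R, is_derive x 1 G (g x).
Proof.
move=> cg; pose N (x : R) := (Num.truncn `|x|).+1.
have xN (x : R) (n : nat) : `|x| < n%:R -> - n%:R < x by rewrite ltr_norml => /andP[].
have NP (x : R) : `|x| < (N x)%:R by rewrite /N truncnS_gt.
have glue (x : R) n m : `|x| < n%:R -> `|x| < m%:R ->
    F g n x - F g n 0 = F g m x - F g m 0.
  move=> xn xm.
  have D (y : R) : `|y| <= `|x| -> is_derive y 1 (F g n - F g m) 0.
    move=> yx; have yn := le_lt_trans yx xn; have ym := le_lt_trans yx xm.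
    have := is_deriveB (is_derive_F cg (xN _ _ yn)) (is_derive_F cg (xN _ _ ym)).
    by rewrite subrr.
  suff : F g n x - F g m x = F g n 0 - F g m 0.
    by move/(congr1 (fun z => z + F g m x - F g n 0)); rewrite subrK => ->; ring.
  have [x0|x0] := leP 0 x.
    apply/esym/(@eq0_derive_cst (F g n - F g m)) => // y /andP[y0 yx].
    by apply: D; rewrite !ger0_norm.
  apply: (@eq0_derive_cst (F g n - F g m)) => [|y /andP[xy y0]]; first exact: ltW.
  by apply: D; rewrite !ler0_norm ?lerN2// ltW.
exists (fun x => F g (N x) x - F g (N x) 0); first by rewrite subrr.
move=> x; pose M := (Num.truncn (`|x| + 1)).+1.
have MP : `|x| + 1 < M%:R by rewrite /M truncnS_gt.
have xM : `|x| < M%:R by rewrite (lt_trans _ MP)// ltrDl.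
have : is_derive x (1 : R) (F g M - cst (F g M 0)) (g x).
  apply: (is_derive_eq (is_deriveB (is_derive_F cg (xN _ _ xM)) (is_derive_cst _ _ _))).
  by rewrite subr0.
apply: near_eq_is_derive; near=> y; apply: glue; last exact: NP.
have : `|y - x| < 1.
  near: y; have := @cvg_id _ (nbhs x); move/cvgrPdist_lt => /(_ 1 ltr01).
  by apply: filterS => y; rewrite distrC.
move=> yx; apply: le_lt_trans MP; rewrite -[y](subrK x) (le_trans (ler_normD _ _))//.
by rewrite addrC lerD2l ltW.
Unshelve. all: by end_near. Qed.

End RealFunctions.

(** * Existence and stability of solutions of differential equations *)

Section Picard.
Variable R : realType.

Lemma is_derive_rV (V : normedModType R) m (u : V -> 'rV[R]_m) x v (d : 'rV[R]_m) :
  (forall j, is_derive x v (fun y => u y ord0 j) (d ord0 j)) -> is_derive x v u d.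
Proof.
move=> du; have D : derivable u x v.
  by apply/derivable_mxP => i j; rewrite ord1; case: (du j).
split=> //; apply/rowP => j; rewrite derive_mx// mxE.
by case: (du j).
Qed.

Lemma is_derive_coord (V : normedModType R) m (u : V -> 'rV[R]_m) x v (d : 'rV[R]_m) j :
  is_derive x v u d -> is_derive x v (fun y => u y ord0 j) (d ord0 j).
Proof.
move=> [du <-]; rewrite derive_mx// mxE; apply: derivableP.
by move/derivable_mxP : du.
Qed.

Lemma is_derive_continuous (W : normedModType R) (u : R -> W) (s : R) d :
  is_derive s 1 u d -> {for s, continuous u}.
Proof. by move=> [du _]; exact/differentiable_continuous/derivable1_diffP. Qed.

Lemma is_derive_rev (W : normedModType R) (u : R -> W) (s : R) d :
  is_derive (- s) 1 u d -> is_derive s 1 (fun t => u (- t)) (- d).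
Proof.
move=> /(is_deriveZdir (-1)); rewrite !scaleN1r => ud.
apply: (@is_derive_affine R R R W u -%R s 1 (-1)) => // h.
by rewrite [h *: 1]mulr1 [h *: -1]mulrN1 opprD.
Qed.

Lemma is_derive_expR_comp (g : R -> R) (s d : R) : is_derive s 1 g d ->
  is_derive s 1 (fun t => expR (g t)) (expR (g s) * d).
Proof. exact: (is_derive1_comp (is_derive_expR (g s))). Qed.

Lemma antiderivative_rV m (g : R -> 'rV[R]_m) (x0 : 'rV[R]_m) : continuous g ->
  exists2 u, u 0 = x0 & forall s : R, is_derive s 1 u (g s).
Proof.
move=> cg.
have cgj j : continuous (fun s => g s ord0 j).
  exact: (@Ck_coord R R 0 m g j cg).
pose G j := s2val (cid2 (continuous_antiderivative (cgj j))).
have G0 j : G j 0 = 0 by rewrite /G; case: (cid2 _).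
have dG j (s : R) : is_derive s 1 (G j) (g s ord0 j) by rewrite /G; case: (cid2 _).
exists (fun s => x0 + \row_j G j s).
  by apply/rowP => j; rewrite !mxE G0 addr0.
move=> s; rewrite -[g s]add0r; apply: is_deriveD; apply: is_derive_rV => j.
by under eq_fun do rewrite mxE; exact: dG.
Qed.

Lemma increment_le m (u u' : R -> 'rV[R]_m) (G g : R -> R) a b : a <= b ->
  (forall s : R, a <= s <= b -> is_derive s 1 u (u' s)) ->
  (forall s : R, a <= s <= b -> is_derive s 1 G (g s)) ->
  (forall s, a <= s <= b -> `|u' s| <= g s) -> `|u b - u a| <= G b - G a.
Proof.
move=> ab du dG ug.
have Gab : G a <= G b.
  apply: (ger0_derive_le ab dG) => s sab.
  exact: le_trans (ug s sab).
apply: normr_rV_le => [|j]; first by rewrite subr_ge0.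
have dj (s : R) : a <= s <= b -> is_derive s 1 (fun t => u t ord0 j) (u' s ord0 j).
  by move=> sab; apply: is_derive_coord; exact: du.
have gj s : a <= s <= b -> `|u' s ord0 j| <= g s.
  by move=> sab; apply: le_trans (ug s sab); exact: normr_coord.
rewrite !mxE ler_norml; apply/andP; split.
  rewrite -subr_ge0.
  have := @ger0_derive_le R (fun t => u t ord0 j + G t) (fun s => u' s ord0 j + g s) a b ab.
  move=> /(_ (fun s sab => is_deriveD (dj s sab) (dG s sab))) h.
  suff : u a ord0 j + G a <= u b ord0 j + G b by lra.
  by apply: h => s sab; have := gj s sab; rewrite ler_norml; lra.
have := @ger0_derive_le R (fun t => G t - u t ord0 j) (fun s => g s - u' s ord0 j) a b ab.
move=> /(_ (fun s sab => is_deriveB (dG s sab) (dj s sab))) h.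
suff : G a - u a ord0 j <= G b - u b ord0 j by lra.
by apply: h => s sab; have := gj s sab; rewrite ler_norml; lra.
Qed.

Lemma increment_le_abs m (u u' : R -> 'rV[R]_m) (G g : R -> R) :
  (forall s : R, is_derive s 1 u (u' s)) ->
  (forall s : R, is_derive s 1 G (g s)) ->
  (forall s, `|u' s| <= g `|s|) -> forall s, `|u s - u 0| <= G `|s| - G 0.
Proof.
move=> du dG ug s; have [s0|s0] := leP 0 s.
  rewrite ger0_norm//; apply: (@increment_le m u u' G g) => // t /andP[t0 _].
  by have := ug t; rewrite ger0_norm.
rewrite ltr0_norm// -{1}(opprK s) -[u 0](congr1 u (oppr0 _)).
apply: (@increment_le m (fun t => u (- t)) (fun t => - u' (- t)) G g) => //.
- by rewrite oppr_ge0 ltW.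
- by move=> t _; exact: is_derive_rev.
- by move=> t /andP[t0 _]; rewrite normrN; have := ug (- t); rewrite normrN ger0_norm.
Qed.

Lemma halving_small (B x : R) : (forall k, x <= 2^-1 ^+ k * B) -> x <= 0.
Proof.
move=> xB; rewrite leNgt; apply/negP => x0.
have := xB (Num.truncn (B / x)); apply/negP; rewrite -ltNge exprVn mulrC.
rewrite ltr_pdivrMr ?exprn_gt0// mulrC -ltr_pdivrMr//.
apply: lt_le_trans (truncnS_gt _) _.
by rewrite -natrX ler_nat ltn_expl.
Qed.

(** In each coordinate the sequences [a k - 2^-k B] and [a k + 2^-k B] are monotone
    and bound each other, so the supremum of the former is the limit. *)
Lemma halving_limit m (a : nat -> 'rV[R]_m) (B : R) : 0 <= B ->
  (forall k, `|a k.+1 - a k| <= 2^-1 ^+ k.+1 * B) ->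
  exists l, forall k, `|l - a k| <= 2^-1 ^+ k * B.
Proof.
move=> B0 aB.
have half k : 2^-1 ^+ k * B = 2^-1 ^+ k.+1 * B + 2^-1 ^+ k.+1 * B.
  by rewrite exprS; field.
have aBj k j : `|a k.+1 ord0 j - a k ord0 j| <= 2^-1 ^+ k.+1 * B.
  by apply: le_trans (aB k); have := normr_coord (a k.+1 - a k) j; rewrite !mxE.
pose lo j k := a k ord0 j - 2^-1 ^+ k * B.
pose hi j k := a k ord0 j + 2^-1 ^+ k * B.
have lohi j k : lo j k <= hi j k.
  by rewrite /lo /hi lerD2l ge0_cp// mulr_ge0// exprn_ge0// invr_ge0.
have loS j : {homo lo j : p q / (p <= q)%N >-> p <= q}.
  apply: homo_leq => [x|x y z|k]; [exact: lexx|exact: le_trans|].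
  by have := aBj k j; rewrite /lo (half k) ler_norml; lra.
have hiS j : {homo hi j : p q / (p <= q)%N >-> q <= p}.
  apply: (@homo_leq _ (hi j) (fun p q => q <= p)) => [x|x y z|k]; first exact: lexx.
    by move=> ? /le_trans; apply.
  by have := aBj k j; rewrite /hi (half k) ler_norml; lra.
have lh j p q : lo j p <= hi j q.
  apply: (le_trans (loS j _ _ (leq_maxl p q))).
  exact: (le_trans (lohi j _) (hiS j _ _ (leq_maxr p q))).
have hs j : has_sup (range (lo j)).
  split; first by exists (lo j 0); exists 0.
  by exists (hi j 0) => _ [p _ <-].
exists (\row_j sup (range (lo j))) => k.
apply: normr_rV_le => [|j]; first by rewrite mulr_ge0// exprn_ge0// invr_ge0.
have : lo j k <= sup (range (lo j)) by apply: ub_le_sup; [case: (hs j)|exists k].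
have : sup (range (lo j)) <= hi j k.
  by apply: ge_sup => [|_ [p _ <-]//]; case: (hs j).
by rewrite !mxE /lo /hi ler_norml; lra.
Qed.

(** The iterates are compared in the norm weighted by [exp(2 * L)], [L] a
    primitive of [l]; there the Picard operator halves distances on the whole
    line at once, without shrinking the time interval. *)
Lemma picard_lindelof m (F : R -> 'rV[R]_m -> 'rV[R]_m) (l : R -> R) x0 :
  (forall u : R -> 'rV[R]_m, continuous u -> continuous (fun s => F s (u s))) ->
  continuous l -> (forall s, l (- s) = l s) ->
  (forall s x y, `|F s x - F s y| <= l s * `|x - y|) ->
  (forall s, `|F s x0| <= l s) ->
  exists2 u : R -> 'rV[R]_m, u 0 = x0 &
    forall s : R, is_derive s 1 u (F s (u s)).
Proof.
move=> cF cl lev lF lx0.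
have labs s : l `|s| = l s by case: (ger0P s).
have l0 s : 0 <= l s by apply: le_trans (lx0 s).
have [L L0 dL] := continuous_antiderivative cl.
pose W (s : R) := expR (2 * L `|s|).
have W0 s : 0 <= W s by exact: expR_ge0.
have dW (c s : R) : is_derive s 1 (fun t => c * expR (2 * L t)) (c * (2 * (l s * expR (2 * L s)))).
  have d2 : is_derive s 1 (fun t => 2 * L t) (2 * l s) by exact: is_deriveZ.
  have := is_deriveZ c (is_derive_expR_comp d2).
  by move=> D; apply: (is_derive_eq D); rewrite /GRing.scale /=; ring.
have LW s : l s <= l s * W s.
  rewrite ler_peMr// /W -expR0 ler_expR mulr_ge0// -L0.
  by apply: (@ger0_derive_le R L l).
(* the Picard operator, extended by the identity to discontinuous curves *)
pose S (u : R -> 'rV[R]_m) : R -> 'rV[R]_m := if pselect (continuous u) is left cu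
  then s2val (cid2 (antiderivative_rV x0 (cF u cu))) else u.
have S0 (u : R -> 'rV[R]_m) : continuous u -> S u 0 = x0.
  by move=> cu; rewrite /S; case: pselect => // ?; case: (cid2 _).
have dS (u : R -> 'rV[R]_m) : continuous u -> forall s : R, is_derive s 1 (S u) (F s (u s)).
  by move=> cu; rewrite /S; case: pselect => // ?; case: (cid2 _).
have cS (u : R -> 'rV[R]_m) : continuous u -> continuous (S u).
  by move=> cu s; exact: is_derive_continuous (dS u cu s).
pose U k : R -> 'rV[R]_m := iter k S (fun _ => x0).
have cU k : continuous (U k).
  by elim: k => [|k IH] /=; [move=> s; exact: cvg_cst|exact: cS].
have U0 k : U k 0 = x0 by case: k => [|k] //=; exact: S0.
have weigh (u v : R -> 'rV[R]_m) (c : R) : 0 <= c -> continuous u -> continuous v ->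
    (forall s, `|u s - v s| <= c * W s) ->
    forall s, `|S u s - S v s| <= 2^-1 * c * W s.
  move=> c0 cu cv uv s.
  have := @increment_le_abs m (fun t => S u t - S v t) (fun s => F s (u s) - F s (v s))
    (fun t => (2^-1 * c) * expR (2 * L t)) _
    (fun s => is_deriveB (dS u cu s) (dS v cv s)) (dW (2^-1 * c)).
  rewrite !S0// subrr => h; have := h _ s; rewrite subr0 => {}h.
  apply: le_trans (h _) _; last first.
    by rewrite gerBl mulr_ge0// ?mulr_ge0// expR_ge0.
  move=> t; apply: le_trans (lF _ _ _) _.
  apply: le_trans (ler_wpM2l (l0 t) (uv t)) _.
  by rewrite labs /W le_eqVlt; apply/orP; left; apply/eqP; field.
have US k s : `|U k.+1 s - U k s| <= 2^-1 ^+ k.+1 * W s.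
  elim: k s => [|k IH] s; last first.
    by rewrite exprS; exact: (weigh (U k.+1) (U k)).
  have := @increment_le_abs m (U 1%N) (fun s => F s x0)
    (fun t => 2^-1 * expR (2 * L t)) _ (dS _ (cU 0%N)) (dW 2^-1).
  rewrite U0 => h; have {}h := h _ s.
  apply: le_trans (h _) _; last by rewrite gerBl mulr_ge0// expR_ge0.
  move=> t; rewrite mulrA mulVf// mul1r labs.
  by apply: le_trans (lx0 t) _; exact: LW.
pose u s := sval (cid (halving_limit (W0 s) (fun k => US k s))).
have uU s k : `|u s - U k s| <= 2^-1 ^+ k * W s by rewrite /u; case: cid.
have cu : continuous u.
  move=> s; apply/cvgrPdist_le => e e0.
  pose B := expR (2 * L (`|s| + 1)).
  have [k kB] : exists k, 2^-1 ^+ k * (2 * B) <= e / 2.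
    apply: contrapT => /forallNP h.
    have : e / 2 <= 0.
      apply: (@halving_small (2 * B)) => k; apply: ltW.
      by rewrite ltNge; apply/negP; exact: h.
    by rewrite leNgt divr_gt0.
  have WB t : `|t| <= `|s| + 1 -> W t <= B.
    move=> ts; rewrite /W ler_expR ler_pM2l//.
    by apply: (@ger0_derive_le R L l) => // x _; exact: l0.
  have cUs : \forall t \near s, `|U k s - U k t| < e / 2.
    by have /cvgrPdist_lt := cU k s; apply; rewrite divr_gt0.
  near=> t.
  have ts : `|t| <= `|s| + 1.
    have : `|s - t| < 1.
      by near: t; have /cvgrPdist_lt := @cvg_id _ (nbhs s); apply.
    rewrite -{2}(subrK s t) => h; rewrite (le_trans (ler_normD _ _))// addrC lerD2l.
    by rewrite distrC ltW.
  have us : `|u s - U k s| <= 2^-1 ^+ k * B.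
    apply: le_trans (uU s k) _; rewrite ler_wpM2l ?exprn_ge0 ?invr_ge0//.
    by apply: WB; rewrite lerDl.
  have ut : `|u t - U k t| <= 2^-1 ^+ k * B.
    by apply: le_trans (uU t k) _; rewrite ler_wpM2l ?exprn_ge0 ?invr_ge0// WB.
  have Ut : `|U k s - U k t| < e / 2 by near: t.
  have -> : u s - u t = (u s - U k s) + ((U k s - U k t) + (U k t - u t)).
    by rewrite !subrKA.
  rewrite distrC in ut.
  apply: le_trans (ler_normD _ _) _; have := ler_normD (U k s - U k t) (U k t - u t).
  by move: us ut Ut kB; lra.
have u0 : u 0 = x0.
  apply/eqP; rewrite -subr_eq0 -normr_le0; apply: (@halving_small (W 0)) => k.
  by have := uU 0 k; rewrite U0.
suff E : S u = u by exists u => // s; rewrite -{1}E; exact: dS.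
apply/funext => t; apply/eqP; rewrite -subr_eq0 -normr_le0.
apply: (@halving_small (2 * W t)) => k.
have h1 : `|S u t - S (U k) t| <= 2^-1 * 2^-1 ^+ k * W t.
  exact: weigh.
have h2 := uU t k.+1.
have -> : S u t - u t = (S u t - S (U k) t) + (S (U k) t - u t).
  by rewrite subrKA.
rewrite distrC exprS in h2; apply: le_trans (ler_normD _ _) _.
apply: le_trans (lerD h1 h2) _.
have : 0 <= 2^-1 ^+ k * W t by rewrite mulr_ge0// exprn_ge0 ?invr_ge0.
by move: (W t) (2^-1 ^+ k) => w p; lra.
Unshelve. all: by end_near. Qed.

(** The sum [q] of the squares of the coordinates is differentiable, unlike the sup
    norm, and equivalent to its square; the differential inequality
    [q' <= M (q + c^2)] is integrated after multiplication by [exp (- M t)]. *)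
Lemma gronwall m (K S : R) : 0 <= K -> exists2 C : R, 1 <= C &
  forall (e e' : R -> 'rV[R]_m) (c : R), 0 <= c ->
  (forall s : R, `|s| <= S -> is_derive s 1 e (e' s)) ->
  (forall s, `|s| <= S -> `|e' s| <= K * `|e s| + c) ->
  forall s, `|s| <= S -> `|e s| <= C * (`|e 0| + c).
Proof.
move=> K0; pose M : R := 2 * m%:R * K + m%:R.
have M0 : 0 <= M by rewrite addr_ge0// !mulr_ge0.
pose C : R := (m%:R + 1) * expR (M * `|S|).
have C1 : 1 <= C.
  rewrite -[leLHS]mulr1; apply: ler_pM => //; first by rewrite lerDr.
  by rewrite -expR0 ler_expR mulr_ge0.
exists C => //.
suff H (e e' : R -> 'rV[R]_m) (c : R) s : 0 <= c -> 0 <= s <= S ->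
    (forall t : R, 0 <= t <= s -> is_derive t 1 e (e' t)) ->
    (forall t, 0 <= t <= s -> `|e' t| <= K * `|e t| + c) ->
    `|e s| <= C * (`|e 0| + c).
  move=> e e' c c0 de ee s sS; have [s0|s0] := leP 0 s.
    have tS t : 0 <= t <= s -> `|t| <= S.
      by move=> /andP[t0 ts]; rewrite ger0_norm// (le_trans ts)// -(ger0_norm s0).
    apply: (H e e') => // [|t /tS/de//|t /tS/ee//].
    by rewrite s0 -(ger0_norm s0).
  have tS t : 0 <= t <= - s -> `|- t| <= S.
    move=> /andP[t0 ts]; rewrite normrN ger0_norm// (le_trans ts)//.
    by rewrite -(ltr0_norm s0).
  have := H (fun t => e (- t)) (fun t => - e' (- t)) c (- s) c0.
  rewrite oppr0 opprK; apply.
  - by rewrite oppr_ge0 ltW//= -(ltr0_norm s0).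
  - by move=> t /tS/de; exact: is_derive_rev.
  - by move=> t /tS/ee; rewrite normrN.
move=> c0 /andP[s0 sS] de ee.
pose q t := \sum_j e t ord0 j ^+ 2.
pose q' t := \sum_j 2 * e t ord0 j * e' t ord0 j.
have q0 t : 0 <= q t by apply: sumr_ge0 => j _; exact: sqr_ge0.
have dq (t : R) : 0 <= t <= s -> is_derive t 1 q (q' t).
  move=> ts; have -> : q = \sum_j (fun t => e t ord0 j ^+ 2).
    by apply/funext => x; rewrite /q fct_sumE.
  apply: is_derive_sum => j.
  have := is_deriveX 2 (is_derive_coord j (de t ts)).
  by move=> D; apply: (is_derive_eq D).
have qe t : `|e t| ^+ 2 <= q t.
  rewrite -(sqr_sqrtr (q0 t)) ler_sqr ?nnegrE ?sqrtr_ge0//.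
  apply: normr_rV_le => [|j]; first exact: sqrtr_ge0.
  rewrite -sqrtr_sqr ler_wsqrtr// /q (bigD1 j)//= lerDl.
  by apply: sumr_ge0 => i _; exact: sqr_ge0.
have eq t : q t <= m%:R * `|e t| ^+ 2.
  apply: (@le_trans _ _ (\sum_(j < m) `|e t| ^+ 2)).
    apply: ler_sum => j _; rewrite -real_normK ?num_real//.
    by rewrite lerXn2r ?nnegrE//; exact: normr_coord.
  by rewrite sumr_const card_ord mulr_natl.
have q'M t : 0 <= t <= s -> q' t <= M * (q t + c ^+ 2).
  move=> ts; apply: (@le_trans _ _ (\sum_(j < m) 2 * (`|e t| * (K * `|e t| + c)))).
    apply: ler_sum => j _; rewrite -mulrA ler_pM2l// (le_trans (ler_norm _))//.
    rewrite normrM ler_pM ?normr_coord// (le_trans (normr_coord _ _))//.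
    exact: ee.
  rewrite sumr_const card_ord -[leLHS]mulr_natl.
  have := qe t; set E := `|e t|; set Q := q t => EQ.
  have : 2 * (E * (K * E + c)) <= 2 * K * E ^+ 2 + E ^+ 2 + c ^+ 2.
    have := sqr_ge0 (E - c); rewrite sqrrB; lra.
  move=> h; apply: (@le_trans _ _ (m%:R * ((2 * K + 1) * (Q + c ^+ 2)))).
    apply: ler_wpM2l => //; apply: le_trans h _.
    have : (2 * K + 1) * E ^+ 2 <= (2 * K + 1) * Q by rewrite ler_wpM2l//; lra.
    have : 0 <= K * c ^+ 2 by rewrite mulr_ge0 ?sqr_ge0.
    by lra.
  by rewrite /M le_eqVlt; apply/orP; left; apply/eqP; ring.
have dE (t : R) : is_derive t 1 (fun t => expR (- M * t)) (expR (- M * t) * (- M)).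
  apply: is_derive_expR_comp; have := is_deriveZ (- M) (is_derive_id t (1 : R)).
  by move=> D; apply: (is_derive_eq D); rewrite [_ *: _]mulr1.
have : (q s + c ^+ 2) * expR (- M * s) <= q 0 + c ^+ 2.
  have dp (t : R) : 0 <= t <= s ->
      is_derive t 1 (fun t => - ((q t + c ^+ 2) * expR (- M * t)))
        ((M * (q t + c ^+ 2) - q' t) * expR (- M * t)).
    move=> ts.
    have D := is_deriveN (is_deriveM (is_deriveD (dq t ts)
      (is_derive_cst (c ^+ 2 : R) t (1 : R))) (dE t)).
    apply: (is_derive_eq D); rewrite -[(q + _) t]/(q t + c ^+ 2).
    by rewrite /GRing.scale /= addr0; ring.
  have := ger0_derive_le s0 dp; rewrite mulr0 expR0 mulr1 lerN2; apply => t ts.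
  by rewrite mulr_ge0 ?expR_ge0// subr_ge0; exact: q'M.
rewrite mulNr expRN ler_pdivrMr ?expR_gt0// => h.
have {}h : `|e s| ^+ 2 <= (m%:R + 1) * (`|e 0| + c) ^+ 2 * expR (M * `|S|).
  apply: le_trans (qe s) _; apply: (@le_trans _ _ (q s + c ^+ 2)).
    by rewrite lerDl sqr_ge0.
  apply: le_trans h _; apply: ler_pM; rewrite ?expR_ge0//.
  - by rewrite addr_ge0// sqr_ge0.
  - rewrite sqrrD mulrDl mul1r; have := eq 0.
    have : 0 <= m%:R * (`|e 0| * c *+ 2 + c ^+ 2).
      by rewrite mulr_ge0// addr_ge0 ?sqr_ge0// mulrn_wge0// mulr_ge0.
    have : 0 <= `|e 0| ^+ 2 + `|e 0| * c *+ 2.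
      by rewrite addr_ge0 ?sqr_ge0// mulrn_wge0// mulr_ge0.
    by lra.
  - by rewrite ler_expR ler_wpM2l// (le_trans sS) ?ler_norm.
have ec : 0 <= `|e 0| + c by rewrite addr_ge0.
rewrite -ler_sqr ?nnegrE ?mulr_ge0 ?(le_trans ler01 C1)//.
apply: le_trans h _; rewrite exprMn mulrAC -/C ler_wpM2r ?sqr_ge0//.
by rewrite expr2 ler_peMl// (le_trans ler01).
Qed.

End Picard.

(** * Smoothness of flows *)

Section Flow.
Variable R : realType.
Implicit Type m : nat.

Definition linearization m p (Y : 'rV[R]_m -> 'rV[R]_p) (x v : 'rV[R]_m) :
  'rV[R]_p := \row_i \sum_j v ord0 j * partial (fun y => Y y ord0 i) j x.

Lemma normr_rV_le_sum m (x : 'rV[R]_m) (c : 'I_m -> R) (d : R) : 0 <= d ->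
  (forall j, 0 <= c j) -> (forall j, `|x ord0 j| <= c j * d) ->
  `|x| <= (\sum_j c j) * d.
Proof.
move=> d0 c0 xc; apply: normr_rV_le => [|j]; first by rewrite mulr_ge0// sumr_ge0.
by rewrite (le_trans (xc j))// ler_wpM2r// (bigD1 j)//= lerDl sumr_ge0.
Qed.

Lemma lipschitz_on_ball_rV m p (Y : 'rV[R]_m -> 'rV[R]_p) (rho : R) : Ck 1 Y ->
  exists2 L : R, 0 <= L & forall x y, `|x| <= rho -> `|y| <= rho ->
    `|Y y - Y x| <= L * `|y - x|.
Proof.
move=> cY; have B i := lipschitz_on_ball rho (Ck_coord i cY).
pose L i := s2val (cid2 (B i)).
have L0 i : 0 <= L i by rewrite /L; case: cid2.
exists (\sum_i L i) => [|x y xr yr]; first exact: sumr_ge0.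
apply: normr_rV_le_sum => // i; rewrite !mxE /L.
by case: cid2 => /= l _; apply.
Qed.

Lemma taylor_on_ball_rV m p (Y : 'rV[R]_m -> 'rV[R]_p) (rho : R) : Ck 2 Y ->
  exists2 M : R, 0 <= M & forall x y, `|x| <= rho -> `|y| <= rho ->
    `|Y y - Y x - linearization Y x (y - x)| <= M * `|y - x| ^+ 2.
Proof.
move=> cY; have B i := taylor_on_ball rho (Ck_coord i cY).
pose M i := s2val (cid2 (B i)).
have M0 i : 0 <= M i by rewrite /M; case: cid2.
exists (\sum_i M i) => [|x y xr yr]; first exact: sumr_ge0.
apply: normr_rV_le_sum => // i.
by rewrite !mxE /M; case: cid2 => /= l _; apply.
Qed.

Lemma bounded_path (V : normedModType R) (x : R -> V) (S : R) : continuous x ->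
  exists rho : R, forall s, `|s| <= S -> `|x s| <= rho.
Proof.
move=> cx; have [S0|S0] := leP 0 S; last first.
  by exists 0 => s /(le_trans (normr_ge0 s)); rewrite leNgt S0.
have SS : - S <= S by lra.
have [|c _ cM] := @EVT_max R (fun s => `|x s|) (- S) S SS.
  apply: continuous_subspaceT => s; apply: (continuous_comp (cx s)).
  exact: norm_continuous.
by exists `|x c| => s; rewrite ler_norml => sS; apply: cM; rewrite in_itv.
Qed.

Definition solution_on m (Y : 'rV[R]_m -> 'rV[R]_m) (S : R) (x : R -> 'rV[R]_m) :=
  forall s : R, `|s| <= S -> is_derive s 1 x (Y (x s)).

(** Both solutions stay in some ball, where the field is Lipschitz. *)
Lemma solution_unique m (Y : 'rV[R]_m -> 'rV[R]_m) (S : R) x x' :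
  Ck 1 Y -> continuous x -> continuous x' ->
  solution_on Y S x -> solution_on Y S x' -> x 0 = x' 0 ->
  forall s, `|s| <= S -> x s = x' s.
Proof.
move=> cY cx cx' dx dx' x0 s sS.
have [r xr] := bounded_path S cx; have [r' xr'] := bounded_path S cx'.
have [L L0 LY] := lipschitz_on_ball_rV (Num.max r r') cY.
have [C _ /(_ (x \- x') (fun s => Y (x s) - Y (x' s)) 0 (lexx 0))] := gronwall m S L0.
move=> /(_ _ _ s sS); rewrite /= x0 subrr normr0 addr0 mulr0 normr_le0 subr_eq0.
move=> h; apply/eqP/h => t tS.
  by apply: is_deriveB; [exact: dx|exact: dx'].
by rewrite addr0 LY// le_max ?xr ?xr' ?orbT.
Qed.

(** The coordinatewise retraction onto the ball of the sup norm. *)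
Definition clip m (rho : R) (x : 'rV[R]_m) : 'rV[R]_m :=
  \row_j Num.max (- rho) (Num.min rho (x ord0 j)).

Lemma clip_id m rho (x : 'rV[R]_m) : `|x| <= rho -> clip rho x = x.
Proof.
move=> xr; apply/rowP => j; rewrite mxE; have := le_trans (normr_coord x j) xr.
by rewrite ler_norml => /andP[h1 h2]; rewrite (min_idPr h2) (max_idPr h1).
Qed.

Lemma clip_ball m rho (x : 'rV[R]_m) : 0 <= rho -> `|clip rho x| <= rho.
Proof.
move=> r0; apply: normr_rV_le => // j; rewrite mxE ler_norml le_max lexx /=.
by rewrite ge_max ge_min lexx andbT/= (le_trans _ r0)// oppr_le0.
Qed.

Lemma clip_lip m rho (x y : 'rV[R]_m) : `|clip rho x - clip rho y| <= `|x - y|.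
Proof.
apply: normr_rV_le => // j; rewrite !mxE.
have h := normr_coord (x - y) j; rewrite !mxE in h; apply: le_trans h.
have maxL (c u v : R) : `|Num.max c u - Num.max c v| <= `|u - v|.
  rewrite ler_norml; case: (ger0P (u - v)) => uv;
    case: (leP c u) => cu; case: (leP c v) => cv; lra.
have minL (c u v : R) : `|Num.min c u - Num.min c v| <= `|u - v|.
  rewrite ler_norml; case: (ger0P (u - v)) => uv;
    case: (leP c u) => cu; case: (leP c v) => cv; lra.
exact: le_trans (maxL _ _ _) (minL _ _ _).
Qed.

Lemma lipschitz_continuous (V W : normedModType R) (Y : V -> W) (L : R) : 0 <= L ->
  (forall x y, `|Y x - Y y| <= L * `|x - y|) -> continuous Y.
Proof.
move=> L0 LY x; apply/cvgrPdist_lt => e e0; near=> y.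
apply: le_lt_trans (LY _ _) _; apply: (@le_lt_trans _ _ ((L + 1) * `|x - y|)).
  by rewrite ler_wpM2r// lerDl.
rewrite mulrC -ltr_pdivlMr ?ltr_wpDl//.
near: y; have /cvgrPdist_lt := @cvg_id _ (nbhs x); apply.
by rewrite divr_gt0// ltr_wpDl.
Unshelve. all: by end_near. Qed.

Lemma lipschitz_solution m (Y : 'rV[R]_m -> 'rV[R]_m) (L : R) y : 0 <= L ->
  (forall x y, `|Y x - Y y| <= L * `|x - y|) ->
  exists2 x : R -> 'rV[R]_m, x 0 = y & forall s : R, is_derive s 1 x (Y (x s)).
Proof.
move=> L0 LY; apply: (@picard_lindelof R m (fun _ => Y) (fun _ => L + `|Y y|)).
- move=> u cu s; apply: (continuous_comp (cu s)).
  exact: (lipschitz_continuous L0 LY).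
- by move=> s; exact: cvg_cst.
- by [].
- by move=> _ u v; apply: le_trans (LY _ _) _; rewrite ler_wpM2r// lerDl.
- by move=> s; rewrite lerDr.
Qed.

Definition is_flow m (Y : 'rV[R]_m -> 'rV[R]_m) (Phi : R -> 'rV[R]_m -> 'rV[R]_m) :=
  (forall y, Phi 0 y = y) /\
  forall (s : R) y, is_derive s 1 (fun t => Phi t y) (Y (Phi s y)).

Lemma lipschitz_flow m (Y : 'rV[R]_m -> 'rV[R]_m) (L : R) : 0 <= L ->
  (forall x y, `|Y x - Y y| <= L * `|x - y|) -> exists Phi, is_flow Y Phi.
Proof.
move=> L0 LY; have E y := lipschitz_solution y L0 LY.
exists (fun s y => s2val (cid2 (E y)) s).
by split=> [y|s y]; case: cid2.
Qed.

Section FlowFacts.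
Variables (m : nat) (Y : 'rV[R]_m -> 'rV[R]_m) (Phi : R -> 'rV[R]_m -> 'rV[R]_m).
Hypotheses (cY : Ck 1 Y) (fPhi : is_flow Y Phi).

Lemma flow_path_continuous y : continuous (fun s => Phi s y).
Proof. by move=> s; apply: is_derive_continuous; exact: fPhi.2. Qed.

Lemma flowD s t y : Phi (s + t) y = Phi s (Phi t y).
Proof.
apply: (@solution_unique m Y `|s| (fun s => Phi (s + t) y)
  (fun s => Phi s (Phi t y))) => //.
- move=> u; apply: (@continuous_comp _ _ _ (fun u => u + t) (Phi ^~ y)).
    by apply: cvgD; [exact: cvg_id|exact: cvg_cst].
  exact: flow_path_continuous.
- exact: flow_path_continuous.
- move=> u _.
  apply: (@is_derive_affine R R R _ (Phi ^~ y) (fun u => u + t) u 1 1).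
    by move=> h; rewrite addrA.
  exact: fPhi.2.
- by move=> u _; exact: fPhi.2.
- by rewrite add0r fPhi.1.
Qed.

(** Nearby trajectories of a field that is only locally Lipschitz: the field is
    clipped outside a ball that contains the reference trajectory, and the
    trajectories of the clipped field that stay in the ball are genuine. *)
Lemma flow_stability (y0 : 'rV[R]_m) (S : R) : exists C d : R, [/\ 1 <= C, 0 < d &
  forall y : 'rV[R]_m, `|y - y0| <= d -> forall s, `|s| <= S ->
    `|Phi s y - Phi s y0| <= C * `|y - y0|].
Proof.
have [r xr] := bounded_path S (@flow_path_continuous y0).
(* a margin of one for the neighbouring trajectories *)
pose rho := `|r| + 1; have rho0 : 0 <= rho by rewrite addr_ge0.
have [L L0 LY] := lipschitz_on_ball_rV rho cY.
pose Z x := Y (clip rho x).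
have LZ x y : `|Z x - Z y| <= L * `|x - y|.
  apply: le_trans (LY _ _ (clip_ball _ rho0) (clip_ball _ rho0)) _.
  by rewrite ler_wpM2l// clip_lip.
have [C C1 G] := gronwall m S L0.
have C0 : 0 < C by rewrite (lt_le_trans ltr01).
exists C, C^-1; split=> [||y yd s sS]//; first by rewrite invr_gt0.
have [x x0 dx] := lipschitz_solution y L0 LZ.
have xP t : `|t| <= S -> `|x t - Phi t y0| <= C * `|y - y0|.
  move=> tS; have := G (x \- Phi ^~ y0) (fun u => Z (x u) - Y (Phi u y0)) 0 (lexx 0).
  move=> /(_ _ _ t tS); rewrite /= x0 fPhi.1 addr0; apply=> u uS.
    by apply: is_deriveB => //; exact: fPhi.2.
  have -> : Y (Phi u y0) = Z (Phi u y0); last by rewrite addr0; exact: LZ.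
  by rewrite /Z clip_id// (le_trans (xr _ uS))// (le_trans (ler_norm r))// lerDl.
suff <- : x s = Phi s y by exact: xP.
apply: (@solution_unique m Y S x (fun s => Phi s y)) => //.
- by move=> t; exact: is_derive_continuous (dx t).
- exact: flow_path_continuous.
- move=> t tS; have := dx t; rewrite /Z clip_id//.
  rewrite -[x t](subrK (Phi t y0)) (le_trans (ler_normD _ _))// addrC.
  rewrite lerD ?(le_trans (xr _ tS)) ?ler_norm// (le_trans (xP t tS))//.
  by rewrite -ler_pdivlMl// mulr1.
- by move=> t _; exact: fPhi.2.
- by rewrite x0 fPhi.1.
Qed.

Lemma flow_continuous : continuous (fun p : R * 'rV[R]_m => Phi p.1 p.2).
Proof.
move=> [s0 y0]; have [C [d [C1 d0 St]]] := flow_stability y0 (`|s0| + 1).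
apply/cvgrPdist_lt => e e0.
have cs : \forall s \near s0, `|Phi s0 y0 - Phi s y0| < e / 2.
  by have /cvgrPdist_lt := @flow_path_continuous y0 s0; apply; rewrite divr_gt0.
have C0 : 0 < C by rewrite (lt_le_trans ltr01).
have cy : \forall y \near y0, `|y - y0| <= Num.min d (e / (2 * C)).
  have /cvgrPdist_lt := @cvg_id _ (nbhs y0) => /(_ (Num.min d (e / (2 * C)))).
  have -> : 0 < Num.min d (e / (2 * C)) by rewrite lt_min d0 divr_gt0// mulr_gt0.
  by move=> /(_ isT); apply: filterS => y; rewrite distrC => /ltW.
have s1 : \forall s \near s0, `|s| <= `|s0| + 1.
  have /cvgrPdist_lt := @cvg_id _ (nbhs s0) => /(_ 1 ltr01).
  apply: filterS => s ss; rewrite -[s](subrK s0) (le_trans (ler_normD _ _))//.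
  by rewrite addrC lerD2l distrC ltW.
near=> p.
have [p1 p2 p3] : [/\ `|p.1| <= `|s0| + 1, `|Phi s0 y0 - Phi p.1 y0| < e / 2 &
    `|p.2 - y0| <= Num.min d (e / (2 * C))].
  near: p.
  exists ([set s | `|s| <= `|s0| + 1 /\ `|Phi s0 y0 - Phi s y0| < e / 2],
          [set y | `|y - y0| <= Num.min d (e / (2 * C))]).
    by split=> //=; apply: filterI.
  by move=> [s y] /= [[]].
move: p3; rewrite le_min => /andP[pd pe].
have h := St p.2 pd p.1 p1.
rewrite /= -(subrKA (Phi p.1 y0)) (le_lt_trans (ler_normD _ _))//.
rewrite [ltRHS]splitr ltr_leD// distrC (le_trans h)//.
by rewrite -ler_pdivlMl// (le_trans pe)// invfM mulrA mulrC.
Unshelve. all: by end_near. Qed.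

End FlowFacts.

Lemma linearizationB m p (Y : 'rV[R]_m -> 'rV[R]_p) x v w :
  linearization Y x (v - w) = linearization Y x v - linearization Y x w.
Proof.
apply/rowP => i; rewrite !mxE -sumrB; apply: eq_bigr => j _.
by rewrite !mxE mulrBl.
Qed.

Lemma linearizationZ m p (Y : 'rV[R]_m -> 'rV[R]_p) x (h : R) v :
  linearization Y x (h *: v) = h *: linearization Y x v.
Proof.
apply/rowP => i; rewrite !mxE mulr_sumr; apply: eq_bigr => j _.
by rewrite !mxE mulrA.
Qed.

Definition linearization_bound m p (Y : 'rV[R]_m -> 'rV[R]_p) x : R :=
  \sum_i \sum_j `|partial (fun y => Y y ord0 i) j x|.

Lemma linearization_le m p (Y : 'rV[R]_m -> 'rV[R]_p) x v :
  `|linearization Y x v| <= linearization_bound Y x * `|v|.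
Proof.
apply: normr_rV_le_sum => [//|i|i]; first exact: sumr_ge0.
rewrite mxE mulr_suml (le_trans (ler_norm_sum _ _ _))//.
by apply: ler_sum => j _; rewrite normrM mulrC ler_wpM2l// normr_coord.
Qed.

Lemma linearization_bound_ge0 m p (Y : 'rV[R]_m -> 'rV[R]_p) x :
  0 <= linearization_bound Y x.
Proof. by apply: sumr_ge0 => i _; exact: sumr_ge0. Qed.

Lemma linearization_bound_continuous m p (Y : 'rV[R]_m -> 'rV[R]_p) :
  Ck 1 Y -> Ck 0 (linearization_bound Y).
Proof.
move=> cY; apply: Ck_sum => i; apply: Ck_sum => j x.
have cp : continuous (partial (fun y => Y y ord0 i) j).
  exact: (Ck_partial j (Ck_coord i cY)).
by apply: (continuous_comp (cp x)); exact: norm_continuous.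
Qed.

Lemma Ck_row_mx (V : normedModType R) k p q (f : V -> 'rV[R]_p) (g : V -> 'rV[R]_q) :
  Ck k f -> Ck k g -> Ck k (fun x => row_mx (f x) (g x)).
Proof.
move=> cf cg; apply: Ck_rV => i; rewrite -(splitK i).
case: (fintype.split i) => j /=.
  by under eq_fun do rewrite row_mxEl; exact: Ck_coord.
by under eq_fun do rewrite row_mxEr; exact: Ck_coord.
Qed.

Section Variational.
Variables (m : nat) (Y : 'rV[R]_m -> 'rV[R]_m) (Phi : R -> 'rV[R]_m -> 'rV[R]_m).
Hypotheses (cY : Cinf Y) (fPhi : is_flow Y Phi).

Lemma variational_solution y v : exists2 J : R -> 'rV[R]_m, J 0 = v &
  forall s : R, is_derive s 1 J (linearization Y (Phi s y) (J s)).
Proof.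
pose A s := linearization_bound Y (Phi s y).
have A0 s : 0 <= A s by exact: linearization_bound_ge0.
have cP := @flow_path_continuous _ _ _ fPhi y.
have cA : continuous A.
  move=> s; apply: (continuous_comp (cP s)).
  exact: linearization_bound_continuous (cY 1) _.
(* the bound has to be even in [s], and to dominate the field at the initial value [v] *)
apply: (@picard_lindelof R m (fun s => linearization Y (Phi s y))
  (fun s => (A s + A (- s)) * (1 + `|v|))).
- move=> u cu; apply: continuous_rV => i.
  under eq_fun do rewrite mxE.
  move=> s; apply: cvg_big => [|j _]; first exact: add_continuous.
  have cp : continuous (partial (fun y => Y y ord0 i) j).
    exact: (Ck_partial j (Ck_coord i (cY 1))).
  apply: cvgM; first exact: (@Ck_coord _ _ 0 _ u j cu s).
  exact: (continuous_comp (cP s) (cp _)).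
- move=> s; apply: cvgM; last exact: cvg_cst.
  apply: cvgD; first exact: cA.
  by apply: (@continuous_comp _ _ _ -%R A); [exact: oppr_continuous|exact: cA].
- by move=> s; rewrite opprK addrC.
- move=> s x x'; rewrite -linearizationB (le_trans (linearization_le _ _ _))//.
  by rewrite ler_wpM2r// -[leLHS]mulr1 ler_pM ?lerDl//; exact: A0.
- move=> s; rewrite (le_trans (linearization_le _ _ _))//.
  by rewrite ler_pM ?lerDl// ?lerDr//; exact: A0.
Qed.

(** Introduced as a solution of the linearized equation along the trajectory of
    [y]; that it is the derivative of the flow is [is_derive_flow_init]. *)
Definition variation (s : R) (y v : 'rV[R]_m) : 'rV[R]_m :=
  s2val (cid2 (variational_solution y v)) s.

Lemma variation0 y v : variation 0 y v = v.
Proof. by rewrite /variation; case: cid2. Qed.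

Lemma is_derive_variation (s : R) y v :
  is_derive s 1 (fun t => variation t y v)
    (linearization Y (Phi s y) (variation s y v)).
Proof. by rewrite /variation; case: cid2. Qed.

(** By Taylor the error [Phi s (y + h v) - Phi s y - h J s] solves the linearized
    equation up to [O(h^2)], hence is [O(h^2)] itself. *)
Lemma is_derive_flow_init s y v :
  is_derive y v (fun x => Phi s x) (variation s y v).
Proof.
have [C [d [C1 d0 St]]] := flow_stability (cY 1) fPhi y `|s|.
have C0 : 0 < C by rewrite (lt_le_trans ltr01).
have cP := @flow_path_continuous _ _ _ fPhi y.
have [r xr] := bounded_path `|s| cP.
have [M M0 TM] := taylor_on_ball_rV (r + C * d) (cY 2).
have cA : continuous (fun t => linearization_bound Y (Phi t y)).
  move=> t; apply: (continuous_comp (cP t)).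
  exact: linearization_bound_continuous (cY 1) _.
have [K AK] := bounded_path `|s| cA.
have K0 : 0 <= K.
  by apply: le_trans (AK 0 _); rewrite ?normr0.
have [G G1 GG] := gronwall m `|s| K0.
have key (h : R) : `|h *: v| <= d ->
    `|Phi s (h *: v + y) - Phi s y - h *: variation s y v| <=
    G * M * C ^+ 2 * `|v| ^+ 2 * `|h| ^+ 2.
  move=> hd; pose c := M * (C * `|h *: v|) ^+ 2.
  have c0 : 0 <= c by rewrite mulr_ge0// sqr_ge0.
  have hP t : `|t| <= `|s| -> `|Phi t (h *: v + y) - Phi t y| <= C * `|h *: v|.
    by move=> ts; have := St (h *: v + y); rewrite addrK; apply.
  have := GG (fun t => Phi t (h *: v + y) - Phi t y - h *: variation t y v)
    (fun t => Y (Phi t (h *: v + y)) - Y (Phi t y) -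
       h *: linearization Y (Phi t y) (variation t y v)) c c0 _ _ s (lexx _).
  rewrite !fPhi.1 variation0 addrK subrr normr0 add0r => H.
  apply: le_trans (H _ _) _ => [t ts|t ts|].
  - apply: is_deriveB; first by apply: is_deriveB; exact: fPhi.2.
    by apply: is_deriveZ; exact: is_derive_variation.
  - set D := Phi t (h *: v + y) - Phi t y; set L := linearization Y (Phi t y).
    have -> : Y (Phi t (h *: v + y)) - Y (Phi t y) - h *: L (variation t y v) =
        L (D - h *: variation t y v) + (Y (Phi t (h *: v + y)) - Y (Phi t y) - L D).
      by rewrite /L linearizationB linearizationZ [RHS]addrC subrKA.
    rewrite (le_trans (ler_normD _ _))// lerD//.
      rewrite (le_trans (linearization_le _ _ _))// ler_wpM2r//.
      exact: le_trans (ler_norm _) (AK t ts).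
    have tr : `|Phi t y| <= r + C * d.
      by rewrite (le_trans (xr t ts))// lerDl mulr_ge0// ltW.
    have hr : `|Phi t (h *: v + y)| <= r + C * d.
      rewrite -[Phi t (h *: v + y)](subrK (Phi t y)) addrC.
      rewrite (le_trans (ler_normD _ _))// lerD ?xr// (le_trans (hP t ts))//.
      by rewrite ler_wpM2l// ltW.
    apply: le_trans (TM _ _ tr hr) _; rewrite ler_wpM2l//.
    by rewrite lerXn2r ?nnegrE ?mulr_ge0 ?(ltW C0)// hP.
  - by rewrite /c normrZ !exprMn le_eqVlt; apply/orP; left; apply/eqP; ring.
have cv : h^-1 *: (Phi s (h *: v + y) - Phi s y) @[h --> 0^'] --> variation s y v.
  apply/cvgrPdist_le => e e0.
  pose B := G * M * C ^+ 2 * `|v| ^+ 2.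
  have B0 : 0 <= B.
    by rewrite /B !mulr_ge0 ?sqr_ge0// (le_trans ler01).
  near=> h.
  have h0 : h != 0 by near: h; exact: nbhs_dnbhs_neq.
  have hd : `|h *: v| <= d.
    have : `|h| <= d / (`|v| + 1).
      by near: h; apply: dnbhs0_le; rewrite divr_gt0// ltr_wpDl.
    rewrite ler_pdivlMr ?ltr_wpDl// normrZ; apply: le_trans.
    by rewrite ler_wpM2l// lerDl.
  have -> : variation s y v - h^-1 *: (Phi s (h *: v + y) - Phi s y) =
      - (h^-1 *: (Phi s (h *: v + y) - Phi s y - h *: variation s y v)).
    by rewrite [in RHS]scalerBr scalerA mulVf// scale1r opprB.
  rewrite normrN normrZ normfV ler_pdivrMl ?normr_gt0//.
  apply: le_trans (key h hd) _; rewrite -/B.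
  have hB : `|h| <= e / (B + 1).
    by near: h; apply: dnbhs0_le; rewrite divr_gt0// (ltr_wpDl B0).
  rewrite ler_pdivlMr ?ltr_wpDl// in hB.
  have : `|h| * (`|h| * (B + 1)) <= `|h| * e by rewrite ler_wpM2l.
  have : 0 <= `|h| ^+ 2 by exact: sqr_ge0.
  by lra.
split; first by apply/cvg_ex; eexists; exact: cv.
exact: cvg_lim cv.
Unshelve. all: by end_near. Qed.

Definition tangent_field (w : 'rV[R]_(m + m)) : 'rV[R]_(m + m) :=
  row_mx (Y (lsubmx w)) (linearization Y (lsubmx w) (rsubmx w)).

Definition tangent_flow (s : R) (w : 'rV[R]_(m + m)) : 'rV[R]_(m + m) :=
  row_mx (Phi s (lsubmx w)) (variation s (lsubmx w) (rsubmx w)).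

Lemma Cinf_tangent_field : Cinf tangent_field.
Proof.
move=> k; have cl : Ck k (fun w : 'rV[R]_(m + m) => lsubmx w).
  by apply: Ck_rV => j; under eq_fun do rewrite mxE; exact: (@Ck_coord R _ k _ id _ (@Ck_id R (m + m) k)).
apply: Ck_row_mx; apply: Ck_rV => j.
  apply: (@Ck_comp R _ m k (fun y => Y y ord0 j) _ _ cl) => l.
  exact: Ck_coord.
under eq_fun do rewrite mxE.
apply: Ck_sum => a; apply: CkM.
  by under eq_fun do rewrite mxE; exact: (@Ck_coord R _ k _ id _ (@Ck_id R (m + m) k)).
apply: (@Ck_comp R _ m k (partial (fun y => Y y ord0 j) a) _ _ cl) => l.
exact/Ck_partial/Ck_coord.
Qed.

Lemma tangent_flowP : is_flow tangent_field tangent_flow.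
Proof.
split=> [w|s w]; first by rewrite /tangent_flow fPhi.1 variation0 hsubmxK.
apply: is_derive_rV => i; rewrite -(splitK i); case: (fintype.split i) => j /=.
  under eq_fun do rewrite row_mxEl.
  rewrite row_mxEl row_mxKl; apply: is_derive_coord; exact: fPhi.2.
under eq_fun do rewrite row_mxEr.
rewrite row_mxEr row_mxKl row_mxKr; apply: is_derive_coord.
exact: is_derive_variation.
Qed.

Lemma variation_tangent_flow s y v j :
  variation s y v ord0 j = tangent_flow s (row_mx y v) ord0 (rshift m j).
Proof. by rewrite /tangent_flow row_mxEr row_mxKl row_mxKr. Qed.

(** Along [(s, 0)] the flow has the derivative given by the field, and along
    [(0, v)] the one given by the linearized equation; the latter is continuous, so
    the two add up. *)
Lemma is_derive_flow (p q : R * 'rV[R]_m) :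
  (forall v j, continuous
     (fun p : R * 'rV[R]_m => variation p.1 p.2 v ord0 j)) ->
  is_derive p q (fun p => Phi p.1 p.2)
    (q.1 *: Y (Phi p.1 p.2) + variation p.1 p.2 q.2).
Proof.
move=> cJ; apply: is_derive_rV => j.
have Ds (x : R * 'rV[R]_m) : is_derive x (q.1, 0) (fun p => Phi p.1 p.2 ord0 j)
    ((q.1 *: Y (Phi x.1 x.2)) ord0 j).
  apply: (@is_derive_along _ _ _ _ _ (fun t => Phi t x.2 ord0 j) x (q.1, 0) x.1 q.1).
    by move=> h /=; rewrite scaler0 add0r.
  rewrite mxE; have := is_deriveZdir q.1 (is_derive_coord j (fPhi.2 x.1 x.2)).
  by rewrite [q.1 *: 1]mulr1.
have Dy (x : R * 'rV[R]_m) : is_derive x (0, q.2) (fun p => Phi p.1 p.2 ord0 j)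
    (variation x.1 x.2 q.2 ord0 j).
  apply: (@is_derive_along _ _ _ _ _ (fun y => Phi x.1 y ord0 j) x (0, q.2) x.2 q.2).
    by move=> h /=; rewrite scaler0 add0r.
  exact: (is_derive_coord j (is_derive_flow_init x.1 x.2 q.2)).
have E : 'D_(0, q.2) (fun p : R * 'rV[R]_m => Phi p.1 p.2 ord0 j) =
    (fun x => variation x.1 x.2 q.2 ord0 j).
  by apply/funext => x; case: (Dy x).
have := @is_deriveDdir R _ (fun p : R * 'rV[R]_m => Phi p.1 p.2 ord0 j) p
  (q.1, 0) (0, q.2) _ (Ds p).
have -> : (q.1, 0) + (0, q.2) = q.
  by case: q {Ds Dy E} => a b; rewrite -[LHS]/(a + 0, 0 + b) addr0 add0r.
case: (Dy p) => _ ->; rewrite E => H; rewrite mxE; apply: H => [y|].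
  by case: (Dy y).
exact: cJ.
Qed.

End Variational.

(** The derivative of the flow of [Y] is expressed by the flow of the tangent
    field of [Y], so that the order of differentiability increases by itself. *)
Theorem flow_Cinf m (Y : 'rV[R]_m -> 'rV[R]_m) Phi : Cinf Y -> is_flow Y Phi ->
  Cinf (fun p : R * 'rV[R]_m => Phi p.1 p.2).
Proof.
move=> cY fPhi k; elim: k m Y Phi cY fPhi => [|k IH] m Y Phi cY fPhi.
  exact: flow_continuous (cY 1) fPhi.
have cJ l : (forall j, Ck l (fun p : R * 'rV[R]_(m + m) =>
      tangent_flow cY fPhi p.1 p.2 ord0 j)) ->
    forall v j, Ck l (fun p : R * 'rV[R]_m => variation cY fPhi p.1 p.2 v ord0 j).
  move=> cT v j; under eq_fun do rewrite variation_tangent_flow.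
  apply: (@Ck_affine R _ _ _ l (fun p : R * 'rV[R]_(m + m) =>
      tangent_flow cY fPhi p.1 p.2 ord0 (rshift m j))
    (fun p : R * 'rV[R]_m => (p.1, row_mx p.2 v))
    (fun p => (p.1, row_mx p.2 0))) => //.
    have c2 : continuous (fun p : R * 'rV[R]_m => row_mx p.2 v).
      by apply: (@Ck_row_mx _ 0) => [y|y]; [exact: cvg_snd|exact: cvg_cst].
    have c1 : continuous (fun p : R * 'rV[R]_m => p.1) by move=> x; exact: cvg_fst.
    by move=> x; exact: cvg_pair (c1 x) (c2 x).
  move=> [t y] [u w] h.
  rewrite -[RHS]/(h *: u + t, h *: row_mx w 0 + row_mx y v).
  by rewrite scale_row_mx add_row_mx scaler0 add0r.
have fT := tangent_flowP cY fPhi; have cT := Cinf_tangent_field cY.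
have cT0 : Ck 0 (fun p : R * 'rV[R]_(m + m) => tangent_flow cY fPhi p.1 p.2).
  exact: flow_continuous (cT 1) fT.
have D p q := @is_derive_flow m Y Phi cY fPhi p q
  (cJ 0%N (fun j => Ck_coord j cT0)).
split; first exact: flow_continuous (cY 1) fPhi.
move=> q; split=> [p|]; first by case: (D p q).
rewrite (_ : 'D_q _ = (fun p => q.1 *: Y (Phi p.1 p.2) +
    variation cY fPhi p.1 p.2 q.2)); last by apply/funext => p; case: (D p q).
apply: CkD; apply: Ck_rV => j.
  under eq_fun do rewrite mxE; apply: CkM; first exact: Ck_cst.
  apply: (@Ck_comp R _ m k (fun y => Y y ord0 j) _ _ (IH _ _ _ cY fPhi)) => l.
  exact: Ck_coord.
by apply: cJ => i; apply: Ck_coord; exact: IH cT fT.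
Qed.

End Flow.

(** * Invariance along trajectories *)

Section Invariance.
Variable R : realType.

(** At the infimum of the parameters where the strict inequality fails, the large
    inequality holds up to that parameter by continuity, hence the strict one holds
    there, and then also a little further. *)
Lemma stays_above (f : R -> R) (c : R) : continuous f -> c < f 0 ->
  (forall x, 0 <= x <= 1 -> (forall y, 0 <= y <= x -> c <= f y) -> c < f x) ->
  forall x, 0 <= x <= 1 -> c < f x.
Proof.
move=> cf f0 step x x01; rewrite ltNge; apply/negP => fx.
pose B := [set y | 0 <= y <= 1 /\ f y <= c].
have iB : has_inf B by split; [exists x|exists 0 => y [/andP[]]].
pose i := inf B.
have Bx : B x by [].
have i0 : 0 <= i by apply: lb_le_inf; [exists x|move=> y [/andP[]]].
have ix : i <= x by apply: ge_inf => //; exact: iB.2.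
have i1 : i <= 1 by case/andP: x01 => _; exact: le_trans.
have below y : 0 <= y < i -> c < f y.
  move=> /andP[y0 yi]; rewrite ltNge; apply/negP => fy.
  have : i <= y.
    apply: ge_inf; first exact: iB.2.
    by split=> //; rewrite y0 (le_trans (ltW yi)).
  by rewrite leNgt yi.
have fi : c <= f i.
  rewrite leNgt; apply/negP => fic.
  have ip : 0 < i by rewrite lt_neqAle i0 andbT; apply: contraTneq fic => <-; rewrite -leNgt ltW.
  have near1 : \forall y \near i, f y < c.
    have /cvgrPdist_lt := cf i => /(_ (c - f i)); rewrite subr_gt0 => /(_ fic).
    by apply: filterS => y; rewrite ltr_norml => /andP[+ _]; lra.
  have [e /= e0 ie] := near1.
  pose y := Num.max 0 (i - e / 2).
  have yi : y < i by rewrite /y gt_max ip/= ltrBlDr ltrDl divr_gt0.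
  have y0 : 0 <= y by rewrite /y le_max lexx.
  have := below y; rewrite y0 yi => /(_ isT); apply/negP; rewrite -leNgt ltW//.
  apply: ie => /=; rewrite ger0_norm ?subr_ge0 ?(ltW yi)//.
  have : i - e / 2 <= y by rewrite /y le_max lexx orbT.
  by have := e0; lra.
have {}fi : c < f i.
  apply: step; first by rewrite i0.
  move=> y /andP[y0]; rewrite le_eqVlt => /predU1P[->//|yi].
  by apply/ltW/below; rewrite y0.
have near1 : \forall y \near i, c < f y.
  have /cvgrPdist_lt := cf i => /(_ (f i - c)); rewrite subr_gt0 => /(_ fi).
  by apply: filterS => y; rewrite ltr_norml => /andP[_]; lra.
have [e /= e0 ie] := near1.
have [y By yi] := inf_adherent e0 iB.
have : i <= y by apply: ge_inf => //; exact: iB.2.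
move=> iy; have : c < f y.
  by apply: ie => /=; rewrite ler0_norm ?subr_le0// opprB -/i ltrBlDl.
by rewrite ltNge; case: By => _ ->.
Qed.

Lemma exp_solution (d g : R -> R) : continuous g ->
  (forall s : R, is_derive s 1 d (g s * d s)) ->
  exists2 E : R -> R, (forall s, 0 < E s) & forall s, d s = d 0 * E s.
Proof.
move=> cg dd; have [G G0 dG] := continuous_antiderivative cg.
exists (fun s => expR (G s)) => s; first exact: expR_gt0.
have dE (t : R) : is_derive t 1 (fun u => d u * expR (- G u)) 0.
  have D := is_deriveM (dd t) (is_derive_expR_comp (is_deriveN (dG t))).
  by apply: (is_derive_eq D); rewrite /GRing.scale /= -[(- G) t]/(- G t); ring.
have : d s * expR (- G s) = d 0 * expR (- G 0).
  have [s0|s0] := leP 0 s; first by apply/esym/(@eq0_derive_cst _ (fun u => d u * expR (- G u))).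
  by apply: (@eq0_derive_cst _ (fun u => d u * expR (- G u))) => //; exact: ltW.
rewrite G0 oppr0 expR0 mulr1 => <-.
by rewrite -mulrA -expRD addNr expR0 mulr1.
Qed.

(** Two points are in a common ball slightly larger than the support, or the
    function vanishes at both, or they are at distance at least one. *)
Lemma compact_support_lipschitz m (f : 'rV[R]_m -> R) (rho : R) : Ck 1 f ->
  (forall x, rho < `|x| -> f x = 0) ->
  exists2 L : R, 0 <= L & forall x y, `|f x - f y| <= L * `|x - y|.
Proof.
move=> cf f0.
have [L L0 fL] := lipschitz_on_ball (rho + 1) cf.
have [M M0 fM] := @bounded_on_ball _ _ f rho (Ck_continuous cf).
exists (L + M) => [|x y]; first exact: addr_ge0.
wlog xy : x y / `|x| <= `|y|.
  move=> H; have [/H//|/ltW/H] := leP `|x| `|y|.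
  by rewrite distrC [`|y - x|]distrC.
have [y1|y1] := leP `|y| (rho + 1).
  rewrite distrC [`|x - y|]distrC (le_trans (fL _ _ (le_trans xy y1) y1))//.
  by rewrite ler_wpM2r// lerDl.
rewrite (f0 y) ?subr0; last by rewrite (lt_trans _ y1)// ltrDl.
have [xr|xr] := leP `|x| rho; last by rewrite f0// normr0 mulr_ge0// addr_ge0.
apply: (@le_trans _ _ M); first exact: fM.
have h : 1 <= `|x - y| by have := ler_distD 0 x y; have := lerB_dist y x; rewrite distrC; lra.
rewrite -[leLHS]mulr1; apply: ler_pM => //; by rewrite lerDr.
Qed.

End Invariance.

(** * The Euclidean scalar product *)

Section Dot.
Variable R : realType.

Definition dot m (u v : 'rV[R]_m) : R := \sum_j u ord0 j * v ord0 j.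

Lemma dotC m (u v : 'rV[R]_m) : dot u v = dot v u.
Proof. by apply: eq_bigr => j _; rewrite mulrC. Qed.

Lemma dotDr m (u v w : 'rV[R]_m) : dot u (v + w) = dot u v + dot u w.
Proof. by rewrite -big_split; apply: eq_bigr => j _; rewrite mxE mulrDr. Qed.

Lemma dotZr m (u v : 'rV[R]_m) (k : R) : dot u (k *: v) = k * dot u v.
Proof. by rewrite mulr_sumr; apply: eq_bigr => j _; rewrite mxE mulrCA. Qed.

Lemma dotNr m (u v : 'rV[R]_m) : dot u (- v) = - dot u v.
Proof. by rewrite -scaleN1r dotZr mulN1r. Qed.

Lemma dot_ge0 m (u : 'rV[R]_m) : 0 <= dot u u.
Proof. by apply: sumr_ge0 => j _; rewrite -expr2 sqr_ge0. Qed.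

Lemma dot_eq0 m (u : 'rV[R]_m) : dot u u = 0 -> u = 0.
Proof.
move/eqP; rewrite psumr_eq0; last by move=> j _; rewrite -expr2 sqr_ge0.
move=> /allP u0; apply/rowP => j; rewrite mxE; apply/eqP.
by have := u0 j (mem_index_enum _); rewrite /= -expr2 sqrf_eq0.
Qed.

Lemma dot_gt0 m (u : 'rV[R]_m) : u != 0 -> 0 < dot u u.
Proof.
by move=> u0; rewrite lt_neqAle dot_ge0 andbT eq_sym; apply: contraNneq u0 => /dot_eq0 ->.
Qed.

Lemma Ck_dot (V : normedModType R) m k (f g : V -> 'rV[R]_m) :
  Ck k f -> Ck k g -> Ck k (fun x => dot (f x) (g x)).
Proof. by move=> cf cg; apply: Ck_sum => j; apply: CkM; exact: Ck_coord. Qed.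

Lemma CkZ (V : normedModType R) m k (f : V -> R) (g : V -> 'rV[R]_m) :
  Ck k f -> Ck k g -> Ck k (fun x => f x *: g x).
Proof.
move=> cf cg; apply: Ck_rV => j; under eq_fun do rewrite mxE.
by apply: CkM => //; exact: Ck_coord.
Qed.

End Dot.

(** * Linear algebra of the horizontal lift *)

Section HorizontalLift.
Variables (R : realType) (m : nat).
Variables (u1 u2 z : 'rV[R]_m) (w1 w2 mu : R).

Definition gramdet : R := dot u1 u1 * dot u2 u2 - dot u1 u2 ^+ 2.

(** [gramdet] times the vector in the span of [u1, u2] with scalar products [w1] and
    [w2] with them. *)
Definition lift2 : 'rV[R]_m :=
  (w1 * dot u2 u2 - w2 * dot u1 u2) *: u1 +
  (w2 * dot u1 u1 - w1 * dot u1 u2) *: u2.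

(** [gramdet] times the component of [z] orthogonal to [u1, u2]. *)
Definition perp : 'rV[R]_m :=
  gramdet *: z - (dot z u1 * dot u2 u2 - dot z u2 * dot u1 u2) *: u1
               - (dot z u2 * dot u1 u1 - dot z u1 * dot u1 u2) *: u2.

(** [lift_den] times a vector with scalar products [w1, w2] with [u1, u2], whose
    scalar product with [z] is a multiple of [mu].  Exact orthogonality to [z] would
    require [perp] to be nonzero; allowing a term that vanishes with [mu] keeps the
    denominator positive where [mu] is. *)
Definition lift3 : 'rV[R]_m :=
  (dot z perp + mu * gramdet) *: lift2 - dot z lift2 *: perp.

Definition lift_den : R := gramdet * (dot z perp + mu * gramdet).

Let dotE := (dotDr, dotNr, dotZr, dotC u2 u1).

Lemma dot_perp1 : dot u1 perp = 0.
Proof. by rewrite /perp !dotE (dotC u1 z) /gramdet; ring. Qed.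

Lemma dot_perp2 : dot u2 perp = 0.
Proof. by rewrite /perp !dotE (dotC u2 z) /gramdet; ring. Qed.

Lemma dot_lift21 : dot u1 lift2 = w1 * gramdet.
Proof. by rewrite /lift2 !dotE /gramdet; ring. Qed.

Lemma dot_lift22 : dot u2 lift2 = w2 * gramdet.
Proof. by rewrite /lift2 !dotE /gramdet; ring. Qed.

Lemma dot_lift31 : dot u1 lift3 = w1 * lift_den.
Proof.
by rewrite /lift3 dotDr dotNr !dotZr dot_perp1 dot_lift21 /lift_den; ring.
Qed.

Lemma dot_lift32 : dot u2 lift3 = w2 * lift_den.
Proof.
by rewrite /lift3 dotDr dotNr !dotZr dot_perp2 dot_lift22 /lift_den; ring.
Qed.

Lemma dot_lift3 : dot z lift3 = mu * (gramdet * dot z lift2).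
Proof. by rewrite /lift3 dotDr dotNr !dotZr; ring. Qed.

Lemma gramdet_gt0 :
  (forall c1 c2 : R, c1 *: u1 + c2 *: u2 = 0 -> c1 = 0 /\ c2 = 0) -> 0 < gramdet.
Proof.
move=> free.
have u10 : 0 < dot u1 u1.
  apply: dot_gt0; apply/negP => /eqP u0; have := free 1 0.
  rewrite u0 !scaler0 scale0r addr0 => /(_ erefl)[/eqP]; rewrite oner_eq0 //.
pose v := dot u1 u1 *: u2 - dot u1 u2 *: u1.
have v0 : 0 < dot v v.
  apply: dot_gt0; apply/negP => /eqP v0; have := free (- dot u1 u2) (dot u1 u1).
  by rewrite scaleNr addrC => /(_ v0)[_ h]; rewrite h ltxx in u10.
have : dot v v = dot u1 u1 * gramdet.
  rewrite {2}/v !dotE (dotC v u2) (dotC v u1) /v !dotE /gramdet; ring.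
by move=> h; rewrite h pmulr_rgt0 in v0.
Qed.

Lemma dot_perp : dot perp perp = gramdet * dot z perp.
Proof.
rewrite {2}/perp 2!dotDr 2!dotNr 3!dotZr (dotC perp u1) (dotC perp u2).
by rewrite dot_perp1 dot_perp2 (dotC perp z); ring.
Qed.

Lemma lift_den_gt0 : 0 < gramdet -> 0 <= mu -> (mu = 0 -> perp != 0) ->
  0 < lift_den.
Proof.
move=> g0 mu0 p0; rewrite mulr_gt0//.
have zp : 0 <= dot z perp by rewrite -(pmulr_rge0 _ g0) -dot_perp dot_ge0.
have [/p0 pn0|mun0] := eqVneq mu 0.
  rewrite ltr_wpDr ?mulr_ge0 ?(ltW g0)//.
  by rewrite -(pmulr_rgt0 _ g0) -dot_perp dot_gt0.
by rewrite ltr_wpDl// mulr_gt0// lt_neqAle eq_sym mun0.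
Qed.

End HorizontalLift.

(** * The trivializing vector field *)

Section Trivialization.
Variables (R : realType) (m : nat) (F1 F2 : 'rV[R]_(1 + m) -> R) (r del : R).
Hypotheses (cF1 : Cinf F1) (cF2 : Cinf F2) (del0 : 0 < del).
Implicit Type x : 'rV[R]_(1 + m).

Definition tcoord x : R := x ord0 (lshift m ord0).
Definition zcoord x : 'rV[R]_m := rsubmx x.
(** The points of the extended space are written as [tz t z]; making time a
    coordinate turns the time-dependent field into an autonomous one. *)
Definition tz (t : R) (z : 'rV[R]_m) : 'rV[R]_(1 + m) := row_mx (const_mx t) z.

Definition grad (F : 'rV[R]_(1 + m) -> R) x : 'rV[R]_m :=
  \row_j partial F (rshift 1 j) x.
Definition dtime (F : 'rV[R]_(1 + m) -> R) x : R := partial F (lshift m ord0) x.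

Definition depth x : R := r ^+ 2 - dot (zcoord x) (zcoord x).

Definition den x : R :=
  lift_den (grad F1 x) (grad F2 x) (zcoord x) (depth x).

(** Equal to 1 for [0 <= t <= 1] on the closed ball, and compactly supported. *)
Definition inside x : R := step (2 + depth x - tcoord x ^+ 2).

(** A positive function that agrees with [den] where [den >= del]: the step is 0 as
    soon as [den <= del / 2]. *)
Definition scale_den x : R :=
  let s := step ((2 * den x - del) / del) in den x * s + (1 - s).

Definition velocity x : 'rV[R]_m := (inside x / scale_den x) *:
  lift3 (grad F1 x) (grad F2 x) (zcoord x) (- dtime F1 x) (- dtime F2 x) (depth x).

Definition field x : 'rV[R]_(1 + m) := row_mx (const_mx 1) (velocity x).

Lemma tcoord_tz t z : tcoord (tz t z) = t.
Proof. by rewrite /tcoord /tz row_mxEl mxE. Qed.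

Lemma zcoord_tz t z : zcoord (tz t z) = z.
Proof. by rewrite /zcoord /tz row_mxKr. Qed.

Lemma tz_eta x : tz (tcoord x) (zcoord x) = x.
Proof.
rewrite -[RHS]hsubmxK /tz; congr row_mx; apply/rowP => j.
by rewrite !mxE ord1.
Qed.

Lemma scale_den_gt0 x : 0 < scale_den x.
Proof.
rewrite /scale_den; have /andP[s0 s1] := step_01 ((2 * den x - del) / del).
have [s00|sn0] := eqVneq (step ((2 * den x - del) / del)) 0.
  by rewrite s00 mulr0 add0r subr0.
have sp : 0 < step ((2 * den x - del) / del) by rewrite lt_neqAle eq_sym sn0.
have : 0 < (2 * den x - del) / del.
  by rewrite ltNge; apply: contraNN sn0 => /step_le0 ->.
rewrite pmulr_lgt0 ?invr_gt0// => h.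
have dx : 0 < den x.
  by rewrite subr_gt0 in h; rewrite -(pmulr_rgt0 _ (ltr0Sn R 1)) (lt_trans del0 h).
by rewrite ltr_wpDr ?subr_ge0// mulr_gt0.
Qed.

Lemma scale_den_eq x : del <= den x -> scale_den x = den x.
Proof.
move=> h; rewrite /scale_den step_ge1 ?mulr1 ?subrr ?addr0//.
by rewrite ler_pdivlMr// mul1r; lra.
Qed.

Lemma inside_eq1 x : 0 <= tcoord x <= 1 -> 0 <= depth x -> inside x = 1.
Proof.
move=> /andP[t0 t1] d0; rewrite /inside step_ge1//.
by have : tcoord x ^+ 2 <= 1 by [rewrite expr_le1]; lra.
Qed.

Lemma inside_far x : 2 + r ^+ 2 < `|x| -> inside x = 0.
Proof.
move=> xr; rewrite /inside step_le0//.
have r0 := sqr_ge0 r.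
have [j xj] : exists j, 2 + r ^+ 2 < `|x ord0 j|.
  apply: contrapT => /forallNP h; move: xr; apply/negP; rewrite -leNgt.
  apply: normr_rV_le => [|j]; first by lra.
  by rewrite leNgt; apply/negP; exact: h.
(* the radius is chosen with [(2 + r^2)^2 >= 2 + r^2] *)
have : (2 + r ^+ 2) ^+ 2 <= x ord0 j ^+ 2.
  by rewrite -[leRHS]real_normK ?num_real// lerXn2r ?nnegrE ?(ltW xj)//; lra.
have : x ord0 j ^+ 2 <= tcoord x ^+ 2 + dot (zcoord x) (zcoord x).
  rewrite -(splitK j); case: (fintype.split j) => i /=.
    by rewrite (ord1 i) /tcoord lerDl dot_ge0.
  rewrite /dot (bigD1 i)//= !mxE -expr2.
  have : 0 <= tcoord x ^+ 2 by exact: sqr_ge0.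
  have : 0 <= \sum_(k | k != i) zcoord x ord0 k * zcoord x ord0 k.
    by apply: sumr_ge0 => k _; rewrite -expr2 sqr_ge0.
  by lra.
rewrite /depth sqrrD; have := sqr_ge0 (r ^+ 2); lra.
Qed.

Let cz : Cinf zcoord.
Proof.
move=> k; apply: Ck_rV => j; under eq_fun do rewrite mxE.
exact: (@Ck_coord R _ k _ id _ (@Ck_id R (1 + m) k)).
Qed.

Let cgrad F : Cinf F -> Cinf (grad F).
Proof.
move=> cF k; apply: Ck_rV => j; under eq_fun do rewrite mxE.
exact: Ck_partial.
Qed.

Let cdepth : Cinf depth.
Proof. by move=> k; apply: CkB; [exact: Ck_cst|exact: Ck_dot]. Qed.

Let cgram k : Ck k (fun x => gramdet (grad F1 x) (grad F2 x)).
Proof.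
by apply: CkB; [apply: CkM|apply: CkX]; apply: Ck_dot; exact: cgrad.
Qed.

Let clift2 k : Ck k (fun x =>
  lift2 (grad F1 x) (grad F2 x) (- dtime F1 x) (- dtime F2 x)).
Proof.
have c1 : Ck k (fun x => - dtime F1 x) by apply: CkN; exact: Ck_partial.
have c2 : Ck k (fun x => - dtime F2 x) by apply: CkN; exact: Ck_partial.
by apply: CkD; (apply: CkZ; last exact: cgrad);
  apply: CkB; apply: CkM => //; apply: Ck_dot; exact: cgrad.
Qed.

Let cperp k : Ck k (fun x => perp (grad F1 x) (grad F2 x) (zcoord x)).
Proof.
have cN (f : 'rV[R]_(1 + m) -> 'rV[R]_m) : Ck k f -> Ck k (fun x => - f x).
  move=> cf; under eq_fun do rewrite -scaleN1r.
  by apply: CkZ => //; exact: Ck_cst.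
have cg1 := cgrad cF1 k; have cg2 := cgrad cF2 k.
apply: CkD; [apply: CkD|]; [exact: CkZ|apply: cN|apply: cN]; apply: CkZ => //;
  by apply: CkB; apply: CkM; apply: Ck_dot.
Qed.

Lemma Cinf_den : Cinf den.
Proof.
move=> k; apply: CkM => //; apply: CkD; last exact: CkM.
by apply: Ck_dot.
Qed.

Let cfactor k : Ck k (fun x => inside x / scale_den x).
Proof.
have cs : Ck k (fun x => step ((2 * den x - del) / del)).
  apply: (Ck_comp_R (@Cinf_step R)); apply: CkM; last exact: Ck_cst.
  apply: CkB; last exact: Ck_cst.
  by apply: CkM; [exact: Ck_cst|exact: Cinf_den].
apply: CkM.
  apply: (Ck_comp_R (@Cinf_step R)); apply: CkB.
    by apply: CkD => //; exact: Ck_cst.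
  by apply: CkX; apply: (@Ck_coord R _ k _ id _ (@Ck_id R (1 + m) k)).
apply: CkV => [x|]; first by rewrite gt_eqF// scale_den_gt0.
apply: CkD; first by apply: CkM => //; exact: Cinf_den.
by apply: CkB => //; exact: Ck_cst.
Qed.

Lemma Cinf_velocity : Cinf velocity.
Proof.
move=> k; apply: CkZ => //; apply: CkD.
  apply: CkZ => //; apply: CkD; last exact: CkM.
  exact: Ck_dot.
under eq_fun do rewrite -scaleNr.
by apply: CkZ => //; apply: CkN; exact: Ck_dot.
Qed.

Lemma Cinf_field : Cinf field.
Proof. by move=> k; apply: Ck_row_mx; [exact: Ck_cst|exact: Cinf_velocity]. Qed.

Lemma field_flow : exists Phi, is_flow field Phi.
Proof.
have B j := @compact_support_lipschitz R _ (fun x => velocity x ord0 j)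
  (2 + r ^+ 2) (Ck_coord j (Cinf_velocity 1)).
have {}B j : exists2 L : R, 0 <= L &
    forall x y, `|velocity x ord0 j - velocity y ord0 j| <= L * `|x - y|.
  by apply: B => x /inside_far xr; rewrite /velocity xr mul0r scale0r mxE.
pose L j := s2val (cid2 (B j)).
have L0 j : 0 <= L j by rewrite /L; case: cid2.
apply: (@lipschitz_flow R _ field (\sum_j L j)); first exact: sumr_ge0.
move=> x y; apply: (@le_trans _ _ `|velocity x - velocity y|); last first.
  apply: normr_rV_le_sum => // j; rewrite mxE [X in _ + X]mxE /L.
  by case: cid2 => /= l _; apply.
rewrite /field opp_row_mx add_row_mx subrr; apply: normr_rV_le => // i.
rewrite -(splitK i); case: (fintype.split i) => j /=.
  by rewrite row_mxEl mxE normr0.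
by rewrite row_mxEr normr_coord.
Qed.

Variable Phi : R -> 'rV[R]_(1 + m) -> 'rV[R]_(1 + m).
Hypothesis fPhi : is_flow field Phi.

Lemma is_derive_path (F : 'rV[R]_(1 + m) -> R) x (s : R) : Cinf F ->
  is_derive s 1 (fun t => F (Phi t x))
    (dtime F (Phi s x) + dot (grad F (Phi s x)) (velocity (Phi s x))).
Proof.
move=> cF; have [dP DP] := fPhi.2 s x.
have := is_derive_comp_rV (cF 1) dP; rewrite DP.
move=> D; apply: (is_derive_eq D); rewrite big_split_ord big_ord1.
rewrite /field row_mxEl mxE mul1r; congr (_ + _); apply: eq_bigr => j _.
by rewrite row_mxEr mulrC; congr (_ * _); rewrite mxE.
Qed.

Definition depth_rate x : R := - 2 * (inside x / scale_den x) *
  (gramdet (grad F1 x) (grad F2 x) * dot (zcoord x)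
    (lift2 (grad F1 x) (grad F2 x) (- dtime F1 x) (- dtime F2 x))).

Lemma continuous_depth_rate : Ck 0 depth_rate.
Proof.
apply: CkM; first by apply: CkM; [exact: Ck_cst|exact: cfactor].
by apply: CkM; [exact: cgram|apply: Ck_dot; [exact: cz|exact: clift2]].
Qed.

Lemma is_derive_depth x (s : R) :
  is_derive s 1 (fun t => depth (Phi t x))
    (depth_rate (Phi s x) * depth (Phi s x)).
Proof.
have dz j : is_derive s 1 (fun t => zcoord (Phi t x) ord0 j)
    (velocity (Phi s x) ord0 j).
  under eq_fun do rewrite mxE.
  have := is_derive_coord (rshift 1 j) (fPhi.2 s x).
  by rewrite /field row_mxEr.
have dd : is_derive s 1 (fun t => dot (zcoord (Phi t x)) (zcoord (Phi t x)))
    (2 * dot (zcoord (Phi s x)) (velocity (Phi s x))).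
  rewrite (_ : (fun t => _) = \sum_j (fun t => zcoord (Phi t x) ord0 j *
     zcoord (Phi t x) ord0 j)); last first.
    by apply/funext => t; rewrite fct_sumE.
  rewrite mulr_sumr; apply: is_derive_sum => j.
  have D := is_deriveM (dz j) (dz j).
  by apply: (is_derive_eq D); rewrite /GRing.scale /=; ring.
have D := is_deriveB (is_derive_cst (r ^+ 2 : R) s (1 : R)) dd.
apply: (is_derive_eq D); rewrite /velocity dotZr dot_lift3 /depth_rate; ring.
Qed.

(** [depth] solves a homogeneous linear equation along trajectories, so that the
    ball, its interior and the sphere are invariant. *)
Lemma depth_flow x : exists2 E : R -> R, (forall s, 0 < E s) &
  forall s, depth (Phi s x) = depth x * E s.
Proof.
have cg : continuous (fun s => depth_rate (Phi s x)).
  move=> s; apply: continuous_comp; last exact: continuous_depth_rate.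
  exact: (flow_path_continuous fPhi).
have [E E0 dE] := @exp_solution R (fun s => depth (Phi s x))
  (fun s => depth_rate (Phi s x)) cg (is_derive_depth x).
by exists E => // s; rewrite dE fPhi.1.
Qed.

Lemma depth_flow_ge0 x s : (0 <= depth (Phi s x)) = (0 <= depth x).
Proof. by have [E E0 ->] := depth_flow x; rewrite pmulr_lge0. Qed.

Lemma depth_flow_eq0 x s : (depth (Phi s x) == 0) = (depth x == 0).
Proof. by have [E E0 ->] := depth_flow x; rewrite mulf_eq0 (gt_eqF (E0 s)) orbF. Qed.

Lemma tcoord_flow x s : tcoord (Phi s x) = tcoord x + s.
Proof.
have D (t : R) : is_derive t 1 (fun t => tcoord (Phi t x) - t) 0.
  have d1 := is_derive_coord (lshift m ord0) (fPhi.2 t x).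
  rewrite /field row_mxEl mxE in d1.
  have D := is_deriveB d1 (is_derive_id t (1 : R)).
  by apply: (is_derive_eq D); rewrite subrr.
have : tcoord (Phi s x) - s = tcoord (Phi 0 x) - 0.
  have [s0|s0] := leP 0 s.
    by apply/esym/(@eq0_derive_cst _ (fun t => tcoord (Phi t x) - t)).
  by apply: (@eq0_derive_cst _ (fun t => tcoord (Phi t x) - t)) => //; exact: ltW.
by rewrite fPhi.1 subr0 => /eqP; rewrite subr_eq => /eqP.
Qed.

(** Where [den] is at least [del] the velocity is an exact horizontal lift. *)
Lemma path_stationary (F : 'rV[R]_(1 + m) -> R) x (s : R) :
  F = F1 \/ F = F2 ->
  0 <= tcoord (Phi s x) <= 1 -> 0 <= depth (Phi s x) -> del <= den (Phi s x) ->
  is_derive s 1 (fun t => F (Phi t x)) 0.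
Proof.
move=> FF t01 d0 dd; have cF : Cinf F by case: FF => ->.
apply: (is_derive_eq (is_derive_path x s cF)).
rewrite /velocity dotZr inside_eq1// mul1r scale_den_eq//.
have dn0 : den (Phi s x) != 0 by rewrite gt_eqF// (lt_le_trans del0).
by case: FF => ->; [rewrite dot_lift31|rewrite dot_lift32];
  rewrite -/(den (Phi s x)) mulrCA mulVf// mulr1 subrr.
Qed.

Variable K : set 'rV[R]_(1 + m).
Hypothesis Kdepth : forall x, K x -> 0 <= depth x.
Hypothesis Kden : forall x, K x -> del < den x.
Hypothesis Kstable : forall x y, K x -> 0 <= tcoord y <= 1 -> 0 <= depth y ->
  (depth y == 0) = (depth x == 0) -> F1 y = F1 x -> F2 y = F2 x -> K y.

(** While [den >= del] the functions [F1], [F2] are constant along the trajectory;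
    as [K] depends only on them and on the position with respect to the ball, the
    trajectory is still in [K], where [den > del] leaves room to continue. *)
Lemma flow_conserves x s : K x -> 0 <= tcoord x <= 1 -> 0 <= tcoord x + s <= 1 ->
  F1 (Phi s x) = F1 x /\ F2 (Phi s x) = F2 x.
Proof.
move=> Kx x01 xs01.
(* [s] may be negative: the parameter [th] runs from 0 to 1 in both cases *)
pose p th := Phi (th * s) x.
have p01 th : 0 <= th <= 1 -> 0 <= tcoord (p th) <= 1.
  rewrite /p tcoord_flow => /andP[th0 th1].
  have -> : tcoord x + th * s = (1 - th) * tcoord x + th * (tcoord x + s) by ring.
  case/andP: x01 => a0 a1; case/andP: xs01 => b0 b1.
  rewrite addr_ge0 ?mulr_ge0 ?subr_ge0//=.
  have : (1 - th) * tcoord x <= (1 - th) * 1 by rewrite ler_wpM2l// subr_ge0.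
  have : th * (tcoord x + s) <= th * 1 by rewrite ler_wpM2l.
  by lra.
have pd th : 0 <= depth (p th) by rewrite depth_flow_ge0 Kdepth.
have p0 : p 0 = x by rewrite /p mul0r fPhi.1.
have const (F : 'rV[R]_(1 + m) -> R) th : F = F1 \/ F = F2 -> 0 <= th <= 1 ->
    (forall y, 0 <= y <= th -> del <= den (p y)) -> F (p th) = F x.
  move=> FF /andP[th0 th1] dy; rewrite -p0.
  apply/esym/(@eq0_derive_cst _ (fun y => F (p y))) => // y /andP[y0 yth].
  have D : is_derive (y * s) (1 : R) (fun t => F (Phi t x)) 0.
    apply: path_stationary => //; [apply: p01|exact: pd|apply: dy].
      by rewrite y0 (le_trans yth).
    by rewrite y0.
  apply: (@is_derive_affine R R R R (fun t => F (Phi t x)) (fun y => y * s) y 1 s).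
    by move=> h; rewrite mulrDl [h *: 1]mulr1.
  by have := is_deriveZdir s D; rewrite scaler0 [s *: 1]mulr1.
have cden : continuous (fun th => den (p th)).
  move=> th; apply: (@is_derive_continuous R R _ th
    (s *: (dtime den (p th) + dot (grad den (p th)) (velocity (p th))))).
  apply: (@is_derive_affine R R R R (fun t => den (Phi t x)) (fun y => y * s) th 1 s).
    by move=> h; rewrite mulrDl [h *: 1]mulr1.
  by have := is_deriveZdir s (is_derive_path x (th * s) Cinf_den); rewrite [s *: 1]mulr1.
have stay := @stays_above R (fun th => den (p th)) del cden.
have {}stay th : 0 <= th <= 1 -> del < den (p th).
  apply: stay th; first by rewrite p0 Kden.
  move=> th th01 dy; apply/Kden/(Kstable Kx).
  - exact: p01.
  - exact: pd.
  - exact: depth_flow_eq0.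
  - by apply: const => //; left.
  - by apply: const => //; right.
have p1 : Phi s x = p 1 by rewrite /p mul1r.
rewrite p1; split; apply: const; rewrite ?ler01 ?lexx//; [by left| |by right|];
  by move=> y y01; apply/ltW/stay.
Qed.

End Trivialization.

Local Open Scope complex_scope.

(** * Complex-valued functions *)

Section ComplexCalculus.
Variable R : realType.
Implicit Type V : normedModType R.

Definition CkC V k (g : V -> R[i]) : Prop :=
  Ck k (fun x => complex.Re (g x)) /\ Ck k (fun x => complex.Im (g x)).

Definition is_deriveC V (x v : V) (g : V -> R[i]) (d : R[i]) : Prop :=
  is_derive x v (fun y => complex.Re (g y)) (complex.Re d) /\
  is_derive x v (fun y => complex.Im (g y)) (complex.Im d).

Lemma ReD (x y : R[i]) : complex.Re (x + y) = complex.Re x + complex.Re y.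
Proof. by case: x y => [a b] [c d]. Qed.

Lemma ImD (x y : R[i]) : complex.Im (x + y) = complex.Im x + complex.Im y.
Proof. by case: x y => [a b] [c d]. Qed.

Lemma ReM (x y : R[i]) : complex.Re (x * y) =
  complex.Re x * complex.Re y - complex.Im x * complex.Im y.
Proof. by case: x y => [a b] [c d]. Qed.

Lemma ImM (x y : R[i]) : complex.Im (x * y) =
  complex.Re x * complex.Im y + complex.Im x * complex.Re y.
Proof. by case: x y => [a b] [c d]. Qed.

Lemma ReJ (x : R[i]) : complex.Re (x^*) = complex.Re x.
Proof. by case: x. Qed.

Lemma ImJ (x : R[i]) : complex.Im (x^*) = - complex.Im x.
Proof. by case: x. Qed.

Lemma complexP (x y : R[i]) : complex.Re x = complex.Re y ->
  complex.Im x = complex.Im y -> x = y.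
Proof. by case: x y => [a b] [c d] /= -> ->. Qed.

Lemma CkC_cst V k (c : R[i]) : CkC k (fun _ : V => c).
Proof. by split; exact: Ck_cst. Qed.

Lemma CkCD V k (f g : V -> R[i]) : CkC k f -> CkC k g -> CkC k (fun x => f x + g x).
Proof.
move=> [f1 f2] [g1 g2]; split.
  by under eq_fun do rewrite ReD; exact: CkD.
by under eq_fun do rewrite ImD; exact: CkD.
Qed.

Lemma CkCM V k (f g : V -> R[i]) : CkC k f -> CkC k g -> CkC k (fun x => f x * g x).
Proof.
move=> [f1 f2] [g1 g2]; split.
  by under eq_fun do rewrite ReM; apply: CkB; exact: CkM.
by under eq_fun do rewrite ImM; apply: CkD; exact: CkM.
Qed.

Lemma CkCX V k (f : V -> R[i]) n : CkC k f -> CkC k (fun x => f x ^+ n).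
Proof.
move=> cf; elim: n => [|n IH].
  by under eq_fun do rewrite expr0; exact: CkC_cst.
by under eq_fun do rewrite exprS; exact: CkCM.
Qed.

Lemma CkCJ V k (f : V -> R[i]) : CkC k f -> CkC k (fun x => (f x)^*).
Proof.
move=> [f1 f2]; split; first by under eq_fun do rewrite ReJ.
by under eq_fun do rewrite ImJ; exact: CkN.
Qed.

Lemma CkC_sum V k (I : Type) (s : seq I) (f : I -> V -> R[i]) :
  (forall i, CkC k (f i)) -> CkC k (fun x => \sum_(i <- s) f i x).
Proof.
move=> cf; elim: s => [|i s IH].
  by under eq_fun do rewrite big_nil; exact: CkC_cst.
by under eq_fun do rewrite big_cons; exact: CkCD.
Qed.

Lemma is_deriveCD V (x v : V) f g a b : is_deriveC x v f a -> is_deriveC x v g b ->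
  is_deriveC x v (fun y => f y + g y) (a + b).
Proof.
move=> [f1 f2] [g1 g2]; split; rewrite ?ReD ?ImD.
  by under eq_fun do rewrite ReD; exact: is_deriveD.
by under eq_fun do rewrite ImD; exact: is_deriveD.
Qed.

Lemma is_deriveCM V (x v : V) f g a b : is_deriveC x v f a -> is_deriveC x v g b ->
  is_deriveC x v (fun y => f y * g y) (a * g x + f x * b).
Proof.
move=> [f1 f2] [g1 g2]; split.
  under eq_fun do rewrite ReM.
  have D := is_deriveB (is_deriveM f1 g1) (is_deriveM f2 g2).
  by apply: (is_derive_eq D); rewrite ReD !ReM /GRing.scale /=; ring.
under eq_fun do rewrite ImM.
have D := is_deriveD (is_deriveM f1 g2) (is_deriveM f2 g1).
by apply: (is_derive_eq D); rewrite ImD !ImM /GRing.scale /=; ring.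
Qed.

Lemma is_deriveC_cst V (x v : V) (c : R[i]) : is_deriveC x v (fun _ => c) 0.
Proof. by split; exact: is_derive_cst. Qed.

Lemma is_deriveC_eq V (x v : V) f (a b : R[i]) : is_deriveC x v f a -> a = b ->
  is_deriveC x v f b.
Proof. by move=> h <-. Qed.

Lemma is_deriveC_sum V (x v : V) (I : Type) (s : seq I) (f : I -> V -> R[i]) a :
  (forall i, is_deriveC x v (f i) (a i)) ->
  is_deriveC x v (fun y => \sum_(i <- s) f i y) (\sum_(i <- s) a i).
Proof.
move=> df; elim: s => [|i s IH].
  rewrite big_nil; have -> : (fun y => \sum_(i <- [::]) f i y) = (fun _ => 0).
    by apply/funext => y; rewrite big_nil.
  exact: is_deriveC_cst.
rewrite big_cons; have -> : (fun y => \sum_(i <- i :: s) f i y) =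
    (fun y => f i y + \sum_(i <- s) f i y).
  by apply/funext => y; rewrite big_cons.
exact: is_deriveCD.
Qed.

(** Logarithmic derivatives: they add up under products, also when the value of
    the function vanishes. *)
Definition is_dlog V (x v : V) (g : V -> R[i]) (c : R[i]) : Prop :=
  is_deriveC x v g (c * g x).

Lemma is_dlogM V (x v : V) f g a b : is_dlog x v f a -> is_dlog x v g b ->
  is_dlog x v (fun y => f y * g y) (a + b).
Proof.
by move=> df dg; apply: (is_deriveC_eq (is_deriveCM df dg)); ring.
Qed.

Lemma is_dlogX V (x v : V) f a n : is_dlog x v f a ->
  is_dlog x v (fun y => f y ^+ n) (n%:R * a).
Proof.
move=> df; elim: n => [|n IH].
  apply: (is_deriveC_eq (is_deriveC_cst x v 1)); by rewrite mul0r mul0r.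
have -> : (fun y => f y ^+ n.+1) = (fun y => f y * f y ^+ n).
  by apply/funext => y; rewrite exprS.
have := is_dlogM df IH; rewrite -natr1 => D.
by apply: (is_deriveC_eq D); rewrite /=; ring.
Qed.

Lemma is_dlogJ V (x v : V) f a : is_dlog x v f a ->
  is_dlog x v (fun y => (f y)^*) a^*.
Proof.
move=> [f1 f2]; rewrite /is_dlog -rmorphM; split.
  by rewrite ReJ; under eq_fun do rewrite ReJ.
rewrite ImJ; under eq_fun do rewrite ImJ.
exact: is_deriveN.
Qed.

Lemma sqrt_le_sqr (q c : R) : 0 <= q -> 0 <= c ->
  (Num.sqrt q <= c) = (q <= c ^+ 2).
Proof.
by move=> q0 c0; rewrite -[in RHS](sqr_sqrtr q0) ler_sqr ?nnegrE.
Qed.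

Lemma sqrt_eq_sqr (q c : R) : 0 <= q -> 0 <= c ->
  (Num.sqrt q = c) <-> (q = c ^+ 2).
Proof.
by move=> q0 c0; split=> [<-|->]; [rewrite sqr_sqrtr|rewrite sqrtr_sqr ger0_norm].
Qed.

Definition sqnormC (x : R[i]) : R := complex.Re x ^+ 2 + complex.Im x ^+ 2.

Lemma sqnormC_ge0 x : 0 <= sqnormC x.
Proof. by rewrite addr_ge0 ?sqr_ge0. Qed.

Lemma normC_le (x : R[i]) (c : R) : 0 <= c ->
  (`|x| <= c%:C) = (sqnormC x <= c ^+ 2).
Proof. by move=> c0; rewrite normc_def lecR sqrt_le_sqr ?sqnormC_ge0. Qed.

Lemma normC_eq (x : R[i]) (c : R) : 0 <= c ->
  `|x| = c%:C <-> sqnormC x = c ^+ 2.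
Proof.
move=> c0; rewrite normc_def -/(sqnormC x) -sqrt_eq_sqr ?sqnormC_ge0//.
by split=> [/complexI|->].
Qed.

End ComplexCalculus.

(** * Gradients of the deformation of mixed polynomials *)

Section MixedPolynomials.
Variables (R : realType) (n : nat) (a b : 'I_n -> nat).
Hypothesis a_gt0 : forall j, (0 < a j)%N.
Notation state := 'rV[R]_(1 + (n + n)).
Implicit Type x : state.

Definition deformation x : R[i] := @f_ R n a b (tcoord x) (zcoord x).
Definition reF x : R := complex.Re (deformation x).
Definition imF x : R := complex.Im (deformation x).

Let zj (j : 'I_n) x : R[i] := @ccoord R n (zcoord x) j.

Lemma Cinf_tcoord : Cinf (@tcoord R (n + n)).
Proof.
by move=> k; apply: (@Ck_coord R _ k _ id _ (@Ck_id R (1 + (n + n)) k)).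
Qed.

Lemma CkC_zj k j : CkC k (zj j).
Proof.
by split=> /=; under eq_fun do rewrite mxE;
  exact: (@Ck_coord R _ k _ id _ (@Ck_id R (1 + (n + n)) k)).
Qed.

Lemma CkC_deformation k : CkC k deformation.
Proof.
have ct : CkC k (fun x => (tcoord x)%:C).
  by split; [exact: Cinf_tcoord|exact: Ck_cst].
have c1t : CkC k (fun x => (1 - tcoord x)%:C).
  split; last exact: Ck_cst.
  by apply: CkB; [exact: Ck_cst|exact: Cinf_tcoord].
apply: CkCD; apply: CkCM => //; apply: CkC_sum => j.
  by apply: CkCM; apply: CkCX; [|apply: CkCJ]; exact: CkC_zj.
by apply: CkCX; exact: CkC_zj.
Qed.

Lemma Cinf_reF : Cinf reF. Proof. by move=> k; case: (CkC_deformation k). Qed.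
Lemma Cinf_imF : Cinf imF. Proof. by move=> k; case: (CkC_deformation k). Qed.

(** The infinitesimal multiplication of the [j]-th complex coordinate by [c]. *)
Definition zdir (c : R[i]) (j : 'I_n) x : 'rV[R]_(n + n) :=
  row_mx (\row_k (if k == j then complex.Re (c * zj j x) else 0))
         (\row_k (if k == j then complex.Im (c * zj j x) else 0)).

Lemma dlog_zj c j k x :
  is_dlog x (tz 0 (zdir c j x)) (zj k) (if k == j then c else 0).
Proof.
have D i : is_derive x (tz 0 (zdir c j x)) (fun y : state => y ord0 (rshift 1 i))
    (zdir c j x ord0 i).
  have := is_derive_coord (rshift 1 i) (is_derive_id x (tz 0 (zdir c j x))).
  by rewrite /tz row_mxEr.
split=> /=; under eq_fun do rewrite mxE.
  apply: (is_derive_eq (D (lshift n k))); rewrite row_mxEl mxE.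
  by case: eqP => [->//|]; rewrite mul0r.
apply: (is_derive_eq (D (rshift n k))); rewrite row_mxEr mxE.
by case: eqP => [->//|]; rewrite mul0r.
Qed.

Lemma is_deriveC_deformation c j x :
  let t := tcoord x in let z := zj j x in
  is_deriveC x (tz 0 (zdir c j x)) deformation
    (((a j + b j)%:R * c + (b j)%:R * c^*) * ((1 - t)%:C * (z ^+ (a j + b j) * z^* ^+ b j))
     + (a j)%:R * c * (t%:C * z ^+ a j)).
Proof.
move=> t z; pose w := tz 0 (zdir c j x).
have dt : is_derive x w (@tcoord R (n + n)) 0.
  have := is_derive_coord (lshift (n + n) ord0) (is_derive_id x w).
  by rewrite /w /tz row_mxEl mxE.
have dtC : is_deriveC x w (fun y => (tcoord y)%:C) 0.
  by split => //=; exact: is_derive_cst.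
have d1tC : is_deriveC x w (fun y => (1 - tcoord y)%:C) 0.
  split => /=; last exact: is_derive_cst.
  have D := is_deriveB (is_derive_cst (1 : R) x w) dt.
  by apply: (is_derive_eq D); rewrite subr0.
pose e k := if k == j then c else 0.
have dA := is_deriveC_sum (index_enum 'I_n) (fun k => is_dlogM (is_dlogX (a k + b k) (dlog_zj c j k x))
  (is_dlogX (b k) (is_dlogJ (dlog_zj c j k x)))).
have dB := is_deriveC_sum (index_enum 'I_n) (fun k => is_dlogX (a k) (dlog_zj c j k x)).
apply: (is_deriveC_eq (is_deriveCD (is_deriveCM d1tC dA) (is_deriveCM dtC dB))).
rewrite /= !mul0r !add0r; congr (_ + _).
  rewrite (bigD1 j)//= eqxx big1 ?addr0; last first.
    by move=> k /negbTE ->; rewrite conjc0 !mulr0 addr0 mul0r.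
  by rewrite -/z -/t; ring.
rewrite (bigD1 j)//= eqxx big1 ?addr0; last first.
  by move=> k /negbTE ->; rewrite !mulr0 mul0r.
by rewrite -/z -/t; ring.
Qed.

Lemma is_derive_grad (F : state -> R) x v : Cinf F ->
  is_derive x (tz 0 v) F (dot (grad F x) v).
Proof.
move=> cF; apply: (is_derive_eq (is_derive_partial x (tz 0 v) (cF 1%N))).
rewrite big_split_ord big_ord1 /= /tz row_mxEl mxE mul0r add0r.
by apply: eq_bigr => j _; rewrite row_mxEr mulrC mxE.
Qed.

Lemma grad_zdir c j x d : is_deriveC x (tz 0 (zdir c j x)) deformation d ->
  dot (grad reF x) (zdir c j x) = complex.Re d /\
  dot (grad imF x) (zdir c j x) = complex.Im d.
Proof.
move=> [[_ d1] [_ d2]].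
have [_ e1] := is_derive_grad x (zdir c j x) Cinf_reF.
have [_ e2] := is_derive_grad x (zdir c j x) Cinf_imF.
by rewrite -e1 -e2 -d1 -d2.
Qed.

Lemma coord_neq0 x : zcoord x != 0 -> exists j, zj j x != 0.
Proof.
move=> z0; apply: contrapT => /forallNP h; move/negP: z0; apply; apply/eqP.
have {}h j : zj j x = 0 by apply/eqP; rewrite -[_ == _]negbK; apply/negP; exact: h.
apply/rowP => i; rewrite -(splitK i); case: (fintype.split i) => j /=.
  by rewrite [RHS]mxE; have := congr1 (@complex.Re R) (h j).
by rewrite [RHS]mxE; have := congr1 (@complex.Im R) (h j).
Qed.

(** Away from the origin a single nonzero coordinate suffices: radially and
    angularly [z^a (t + (1 - t) |z|^2b)] moves in two independent directions. *)
Lemma gramdet_deformation_gt0 x : 0 <= tcoord x <= 1 -> zcoord x != 0 ->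
  0 < gramdet (grad reF x) (grad imF x).
Proof.
move=> /andP[t0 t1] /coord_neq0[j z0]; apply: gramdet_gt0 => c1 c2 c12.
set t := tcoord x in t0 t1; set z := zj j x in z0.
(* [z^(a+b) * conj z^b = |z|^2b * z^a] *)
pose N : R := sqnormC z ^+ b j.
have N0 : 0 < N.
  apply: exprn_gt0; rewrite lt_neqAle sqnormC_ge0 andbT eq_sym.
  apply: contraNneq z0 => /eqP; rewrite paddr_eq0 ?sqr_ge0// !sqrf_eq0.
  by move=> /andP[/eqP h1 /eqP h2]; apply/eqP/complexP.
have zz : z * z^* = (sqnormC z)%:C.
  by apply: complexP; rewrite ?ReM ?ImM ReJ ImJ /sqnormC /=; ring.
have zab : z ^+ (a j + b j) * z^* ^+ b j = N%:C * z ^+ a j.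
  by rewrite exprD -mulrA -exprMn zz -rmorphXn mulrC.
have an0 : 0 < (a j)%:R :> R by rewrite ltr0n.
(* [k1 * w] and [i * k2 * w], with [w = z^a], are the derivatives of the [j]-th term
   under infinitesimal dilations and rotations of [z] *)
pose k1 : R := ((a j + b j + b j)%:R * ((1 - t) * N) + (a j)%:R * t).
pose k2 : R := (a j)%:R * ((1 - t) * N + t).
have s0 : 0 < (1 - t) * N + t.
  have [->|tn0] := eqVneq t 0; first by rewrite subr0 mul1r addr0.
  by rewrite ltr_wpDl ?mulr_ge0 ?subr_ge0 ?(ltW N0)// lt_neqAle eq_sym tn0.
have k20 : 0 < k2 by rewrite mulr_gt0.
have k10 : 0 < k1.
  apply: lt_le_trans k20 _; rewrite /k1 /k2 mulrDr lerD2r ler_wpM2r//.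
    by rewrite mulr_ge0 ?subr_ge0 ?(ltW N0).
  by rewrite ler_nat -addnA leq_addr.
set w := z ^+ a j.
have w0 : w != 0 by rewrite expf_neq0.
have d1 : is_deriveC x (tz 0 (zdir 1 j x)) deformation (k1%:C * w).
  apply: (is_deriveC_eq (is_deriveC_deformation 1 j x)).
  have -> : k1%:C = (a j + b j + b j)%:R * ((1 - t)%:C * N%:C) + (a j)%:R * t%:C.
    by rewrite /k1 [LHS]rmorphD [in LHS]rmorphM [in LHS]rmorphM [in LHS]rmorphM
      !rmorph_nat.
  by rewrite rmorph1 -/t -/z zab -/w !natrD; ring.
pose ic : R[i] := 0 +i* 1.
have d2 : is_deriveC x (tz 0 (zdir ic j x)) deformation (ic * (k2%:C * w)).
  apply: (is_deriveC_eq (is_deriveC_deformation ic j x)).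
  have -> : (ic^*)%R = - ic by apply: complexP; rewrite /= ?oppr0.
  have -> : k2%:C = (a j)%:R * ((1 - t)%:C * N%:C + t%:C).
    by rewrite /k2 [LHS]rmorphM [in LHS]rmorphD [in LHS]rmorphM rmorph_nat.
  by rewrite -/t -/z zab -/w !natrD; ring.
have [e1 e2] := grad_zdir d1; have [e3 e4] := grad_zdir d2.
have dc v : c1 * dot (grad reF x) v + c2 * dot (grad imF x) v = 0.
  rewrite (dotC _ v) (dotC (grad imF x)) -!dotZr -dotDr c12.
  by rewrite /dot big1// => i _; rewrite mxE mulr0.
have := dc (zdir 1 j x); have := dc (zdir ic j x).
rewrite e1 e2 e3 e4 ReM ImM [complex.Re (k1%:C * w)]ReM [complex.Im (k1%:C * w)]ImM.
rewrite ReM ImM [complex.Re (k2%:C * w)]ReM [complex.Im (k2%:C * w)]ImM /=.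
rewrite !mul0r !mul1r !subr0 !addr0 !add0r.
set p := complex.Re w; set q := complex.Im w => h2 h1.
have k1n : k1 != 0 by rewrite gt_eqF.
have k2n : k2 != 0 by rewrite gt_eqF.
have {}h1 : c1 * p + c2 * q = 0.
  by apply: (mulfI k1n); rewrite mulr0 -[RHS]h1; ring.
have {}h2 : c2 * p - c1 * q = 0.
  by apply: (mulfI k2n); rewrite mulr0 -[RHS]h2; ring.
have pq : p ^+ 2 + q ^+ 2 != 0.
  apply: contra_neq w0 => /eqP; rewrite paddr_eq0 ?sqr_ge0// !sqrf_eq0.
  by move=> /andP[/eqP p0 /eqP q0]; exact: complexP.
(* [(c1, c2)] is orthogonal to the nonzero vector [(p, q)] and to its rotation *)
split; apply: (mulIf pq); rewrite mul0r.
  transitivity (p * (c1 * p + c2 * q) - q * (c2 * p - c1 * q)); first by ring.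
  by rewrite h1 h2; ring.
transitivity (q * (c1 * p + c2 * q) + p * (c2 * p - c1 * q)); first by ring.
by rewrite h1 h2; ring.
Qed.

End MixedPolynomials.

(** * Transversality and parallel transport *)

Section Transversality.
Variables (R : realType) (n : nat) (a b : 'I_n -> nat) (r eta0 : R).
Hypothesis a_gt0 : forall j, (0 < a j)%N.
Hypotheses (hr : 0 < r) (heta0 : 0 < eta0).
Notation state := 'rV[R]_(1 + (n + n)).
Notation F1 := (@reF R n a b).
Notation F2 := (@imF R n a b).
Implicit Types (x : state) (z u w : cspace R n).

Lemma enormE z : enorm z = Num.sqrt (dot z z).
Proof. by rewrite /enorm /dot; congr Num.sqrt; apply: eq_bigr => j _; rewrite expr2. Qed.

Lemma sphereP z : sphere r z <-> depth r (tz 0 z) = 0.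
Proof.
rewrite /sphere /= enormE sqrt_eq_sqr ?dot_ge0 ?(ltW hr)// /depth zcoord_tz.
by split=> [->|/eqP]; rewrite ?subrr// subr_eq0 => /eqP.
Qed.

Lemma depth_tz t t' z : depth r (tz t z) = depth r (tz t' z).
Proof. by rewrite /depth !zcoord_tz. Qed.

Lemma ballP z : enorm z <= r <-> 0 <= depth r (tz 0 z).
Proof.
by rewrite enormE sqrt_le_sqr ?dot_ge0 ?(ltW hr)// /depth zcoord_tz subr_ge0.
Qed.

Lemma tangent_derivable (M : set (cspace R n)) z u : tangent M z u ->
  exists c : R -> cspace R n, [/\ is_derive (0 : R) 1 c u, c 0 = z & 
    \forall s \near (0 : R), M (c s)].
Proof.
move=> [e [c [e0 sc Mc c0 du]]]; exists c; split=> //.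
  have [dc _] := sc 1%N 1.
  split; last by rewrite -derive1E.
  by apply: dc; rewrite /= in_itv/= oppr_lt0 e0.
exists e => //= s; rewrite /= sub0r normrN ltr_norml => /Mc.
by [].
Qed.

(** The real and imaginary parts are constant along curves in the fiber. *)
Lemma tangent_fiber t eta z u : tangent (fiber a b t eta) z u ->
  dot (grad F1 (tz t z)) u = 0 /\ dot (grad F2 (tz t z)) u = 0.
Proof.
move=> /tangent_derivable[c [dc c0 Mc]].
have dg : is_derive (0 : R) 1 (fun s => tz t (c s)) (tz 0 u).
  apply: is_derive_rV => i; rewrite -(splitK i); case: (fintype.split i) => j /=.
    under eq_fun do rewrite /tz row_mxEl mxE.
    by rewrite /tz row_mxEl mxE; exact: is_derive_cst.
  under eq_fun do rewrite /tz row_mxEr.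
  by rewrite /tz row_mxEr; exact: is_derive_coord.
have [dg1 Dg] := dg.
have key (F : state -> R) (k : R) : Cinf F ->
    (\forall s \near (0 : R), F (tz t (c s)) = k) -> dot (grad F (tz t z)) u = 0.
  move=> cF Fk; have D := is_derive_comp_rV (cF 1%N) dg1.
  rewrite Dg /= c0 in D.
  have Dk : is_derive (0 : R) 1 (F \o (fun s => tz t (c s))) 0.
    have := is_derive_cst k (0 : R) (1 : R); apply: near_eq_is_derive.
    by apply: filterS Fk => s /= ->.
  have [_ e1] := is_derive_grad (tz t z) u cF.
  have [_ e2] := is_derive_partial (tz t z) (tz 0 u) (cF 1%N).
  by rewrite -e1 e2; case: D => _ <-; case: Dk.
have FM (s : R) : fiber a b t eta (c s) -> deformation a b (tz t (c s)) = eta.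
  by rewrite /deformation tcoord_tz zcoord_tz.
split.
  apply: (key _ (complex.Re eta)); first exact: Cinf_reF.
  by apply: filterS Mc => s /FM; rewrite /reF => ->.
apply: (key _ (complex.Im eta)); first exact: Cinf_imF.
by apply: filterS Mc => s /FM; rewrite /imF => ->.
Qed.

Lemma tangent_sphere z w : tangent (sphere r) z w -> dot z w = 0.
Proof.
move=> /tangent_derivable[c [dc c0 Mc]].
have dd : is_derive (0 : R) 1 (fun s => dot (c s) (c s)) (2 * dot z w).
  rewrite (_ : (fun t => _) = \sum_j (fun t => c t ord0 j * c t ord0 j)); last first.
    by apply/funext => t; rewrite fct_sumE.
  rewrite mulr_sumr; apply: is_derive_sum => j.
  have dj := is_derive_coord j dc.
  by apply: (is_derive_eq (is_deriveM dj dj)); rewrite c0 /GRing.scale /=; ring.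
have dk : is_derive (0 : R) 1 (fun s => dot (c s) (c s)) 0.
  have := is_derive_cst (r ^+ 2) (0 : R) (1 : R); apply: near_eq_is_derive.
  by apply: filterS Mc => s; rewrite /sphere /= enormE sqrt_eq_sqr ?dot_ge0 ?(ltW hr).
have : 2 * dot z w = 0 by case: dd => _ <-; case: dk.
by move/eqP; rewrite mulf_eq0 pnatr_eq0/= => /eqP.
Qed.

Hypothesis htrans : forall (t : R) (eta : R[i]), 0 <= t <= 1 -> `|eta| <= eta0%:C ->
  transverse (fiber a b t eta) (@sphere R n r).

Lemma sphere_neq0 z : sphere r z -> z != 0.
Proof.
move=> /sphereP; rewrite /depth zcoord_tz => h; apply/eqP => z0; move: h.
rewrite z0 /dot big1 ?subr0 => [/eqP|i _]; last by rewrite mxE mul0r.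
by rewrite sqrf_eq0 gt_eqF.
Qed.

(** If the position vector were a combination of the two gradients, it would be
    orthogonal to the tangent spaces of the fiber and of the sphere. *)
Lemma transverse_perp t z : 0 <= t <= 1 -> sphere r z ->
  `|f_ a b t z| <= eta0%:C ->
  perp (grad F1 (tz t z)) (grad F2 (tz t z)) z != 0.
Proof.
move=> t01 sz fz; apply/eqP => p0.
have z0 := sphere_neq0 sz.
have g0 : 0 < gramdet (grad F1 (tz t z)) (grad F2 (tz t z)).
  by apply: gramdet_deformation_gt0; rewrite ?tcoord_tz ?zcoord_tz.
have [u Tu [w Tw zuw]] := htrans t01 fz (erefl _ : fiber a b t _ z) sz z.
have zw := tangent_sphere Tw.
have [u1 u2] := tangent_fiber Tu.
have : dot u (perp (grad F1 (tz t z)) (grad F2 (tz t z)) z) = 0.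
  by rewrite p0 /dot big1// => i _; rewrite mxE mulr0.
rewrite /perp !dotDr !dotNr !dotZr (dotC u (grad F1 _)) (dotC u (grad F2 _)) u1 u2.
rewrite !mulr0 !subr0 => /eqP; rewrite mulf_eq0 gt_eqF//= => /eqP zu.
have : dot z z = 0 by rewrite {2}zuw dotDr zw (dotC z u) zu addr0.
by move/dot_eq0 => zz; rewrite zz eqxx in z0.
Qed.

(** The two alternatives serve the equivalence of the tubes and the isotopy of the
    sphere; a single set, hence a single field, covers both. *)
Definition region : set state := [set x |
  [/\ 0 <= tcoord x <= 1, 0 <= depth r x &
      F1 x ^+ 2 + F2 x ^+ 2 = eta0 ^+ 2 \/
      depth r x = 0 /\ F1 x ^+ 2 + F2 x ^+ 2 <= eta0 ^+ 2]].

Lemma region_sphere x : depth r x = 0 -> sphere r (zcoord x : cspace R n).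
Proof. by move=> d0; apply/sphereP; rewrite (depth_tz _ (tcoord x)) tz_eta. Qed.

Lemma deformation0 x : zcoord x = 0 -> deformation a b x = 0.
Proof.
move=> z0; rewrite /deformation z0.
have c0 (j : 'I_n) : ccoord (0 : cspace R n) j = 0 by rewrite /ccoord !mxE.
have an0 j : (0 : R[i]) ^+ a j = 0 by rewrite expr0n gtn_eqF.
have abn0 j : (0 : R[i]) ^+ (a j + b j) = 0 by rewrite exprD an0 mul0r.
rewrite /f_ /f_ab /f_a !big1 ?mulr0 ?addr0// => j _; rewrite c0 ?an0//.
by rewrite abn0 mul0r.
Qed.

(** Inside the ball [depth] is positive; on the sphere transversality takes over. *)
Lemma region_den_gt0 x : region x -> 0 < den F1 F2 r x.
Proof.
move=> [t01 d0 Fx].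
have fle : F1 x ^+ 2 + F2 x ^+ 2 <= eta0 ^+ 2 by case: Fx => [->//|[]].
have nz : zcoord x != 0.
  case: Fx => [Fx|[/region_sphere/sphere_neq0//]].
  apply/eqP => /deformation0 h; move: Fx; rewrite /reF /imF h /= expr0n addr0.
  by move=> /esym/eqP; rewrite sqrf_eq0 gt_eqF.
apply: lift_den_gt0 => //; first exact: gramdet_deformation_gt0.
move=> dx0.
have := @transverse_perp (tcoord x) (zcoord x) t01; rewrite tz_eta; apply.
  exact: region_sphere.
by rewrite normC_le ?(ltW heta0).
Qed.

Lemma closed_ge0 m (f : 'rV[R]_m -> R) : Ck 0 f -> closed [set x | 0 <= f x].
Proof.
move=> cf; rewrite (_ : [set x | _] = f @^-1` [set y | 0 <= y])//.
by apply: closed_comp; [move=> x _; exact: cf|exact: closed_ge].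
Qed.

Lemma closed_eq0 m (f : 'rV[R]_m -> R) : Ck 0 f -> closed [set x | f x = 0].
Proof.
move=> cf; rewrite (_ : [set x | _] = f @^-1` [set y | y = 0])//.
by apply: closed_comp; [move=> x _; exact: cf|exact: closed_eq].
Qed.

Let sqF x : R := F1 x ^+ 2 + F2 x ^+ 2.

Lemma region_compact : compact region.
Proof.
have ct := @Cinf_tcoord R n 0%N.
have cd : Ck 0 (@depth R (n + n) r).
  apply: CkB; first exact: Ck_cst.
  by apply: Ck_dot; apply: Ck_rV => j; under eq_fun do rewrite mxE;
    apply: (@Ck_coord R _ 0 _ id _ (@Ck_id R (1 + (n + n)) 0)).
have cq : Ck 0 sqF by apply: CkD; apply: CkX; [exact: Cinf_reF|exact: Cinf_imF].
apply: bounded_closed_compact.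
  exists (1 + r); split; first exact: num_real.
  move=> M hM x [/andP[t0 t1] d0 _]; apply: le_trans (ltW hM).
  apply: normr_rV_le => [|i]; first by rewrite addr_ge0// ltW.
  rewrite -(splitK i); case: (fintype.split i) => j /=.
    by rewrite (ord1 j) -/(tcoord x) ger0_norm// (le_trans t1)// lerDl ltW.
  have rx : x ord0 (rshift 1 j) ^+ 2 <= r ^+ 2.
    move: d0; rewrite /depth subr_ge0; apply: le_trans.
    rewrite /dot (bigD1 j)//= !mxE -expr2 lerDl.
    by apply: sumr_ge0 => k _; rewrite -expr2 sqr_ge0.
  apply: (@le_trans _ _ r); last by rewrite lerDr.
  by rewrite -sqrtr_sqr sqrt_le_sqr ?sqr_ge0 ?(ltW hr).
have -> : region = ([set x | 0 <= tcoord x] `&` [set x | 0 <= 1 - tcoord x]) `&`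
    [set x | 0 <= depth r x] `&` ([set x | sqF x - eta0 ^+ 2 = 0] `|`
      ([set x | depth r x = 0] `&` [set x | 0 <= eta0 ^+ 2 - sqF x])).
  apply/seteqP; split=> x.
    move=> [/andP[t0 t1] d0 Fx]; split; first by do !split=> //=; rewrite subr_ge0.
    by case: Fx => [h|[h1 h2]]; [left; rewrite /= /sqF h subrr|right; split=> //=; rewrite subr_ge0].
  move=> [[[t0 t1] d0] Fx]; split=> //; first by rewrite /= subr_ge0 in t1; rewrite t0.
  case: Fx => [/= h|[h1 h2]]; [left|right; split=> //].
    by apply/eqP; rewrite -subr_eq0; apply/eqP.
  by rewrite /= subr_ge0 in h2.
apply: closedI.
  apply: closedI; last exact: closed_ge0.
  by apply: closedI; apply: closed_ge0 => //; apply: CkB => //; exact: Ck_cst.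
apply: closedU.
  by apply: closed_eq0; apply: CkB => //; exact: Ck_cst.
apply: closedI; first exact: closed_eq0.
by apply: closed_ge0; apply: CkB => //; exact: Ck_cst.
Qed.

Lemma region_den : exists2 del : R, 0 < del &
  forall x, region x -> del < den F1 F2 r x.
Proof.
have [K0|/set0P K0] := eqVneq region set0.
  by exists 1 => // x; rewrite K0.
have cD : Ck 0 (den F1 F2 r) by apply: Cinf_den; [exact: Cinf_reF|exact: Cinf_imF].
have [|c Kc cmin] := @EVT_min_rV R _ (den F1 F2 r) region K0 region_compact.
  by apply: continuous_subspaceT => x; exact: cD.
rewrite inE in Kc; have D0 := region_den_gt0 Kc.
exists (den F1 F2 r c / 2); first by rewrite divr_gt0.
move=> x Kx; have : den F1 F2 r c <= den F1 F2 r x by apply: cmin; rewrite inE.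
apply: lt_le_trans; lra.
Qed.

Variables (del : R) (Phi : R -> state -> state).
Hypotheses (del0 : 0 < del) (Kden : forall x, region x -> del < den F1 F2 r x).
Hypothesis fPhi : is_flow (field F1 F2 r del) Phi.

Let cF1 : Cinf F1 := @Cinf_reF R n a b.
Let cF2 : Cinf F2 := @Cinf_imF R n a b.

(** Transport along the trajectories from time [t0] to time [t1]: a diffeomorphism of
    the whole space that restricts to the isotopy of the sphere and to the equivalences
    of the tubes. *)
Definition transport (t0 t1 : R) (z : cspace R n) : cspace R n :=
  zcoord (Phi (t1 - t0) (tz t0 z)).

Lemma transport_tz t0 t1 z : Phi (t1 - t0) (tz t0 z) = tz t1 (transport t0 t1 z).
Proof.
rewrite -[LHS]tz_eta; congr tz.
by rewrite (tcoord_flow fPhi) tcoord_tz addrC subrK.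
Qed.

Lemma transportK t0 t1 z : transport t1 t0 (transport t0 t1 z) = z.
Proof.
rewrite {1}/transport -transport_tz -(flowD (Cinf_field r cF1 cF2 del0 1%N) fPhi).
by rewrite addrC addrA subrK subrr fPhi.1 zcoord_tz.
Qed.

Lemma depth_transport t0 t1 z t :
  depth r (tz t (transport t0 t1 z)) = depth r (Phi (t1 - t0) (tz t0 z)).
Proof. by rewrite transport_tz (depth_tz t t1). Qed.

Lemma transport_sphere t0 t1 z : sphere r z -> sphere r (transport t0 t1 z).
Proof.
move=> /sphereP h; apply/sphereP/eqP; rewrite depth_transport.
by rewrite (depth_flow_eq0 cF1 cF2 del0 fPhi) (depth_tz t0 0) h.
Qed.

Lemma transport_ball t0 t1 z : enorm z <= r -> enorm (transport t0 t1 z) <= r.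
Proof.
move=> /ballP h; apply/ballP; rewrite depth_transport.
by rewrite (depth_flow_ge0 cF1 cF2 del0 fPhi) (depth_tz t0 0).
Qed.

Lemma transport_value t0 t1 z : 0 <= t0 <= 1 -> 0 <= t1 <= 1 -> enorm z <= r ->
  `|f_ a b t0 z| = eta0%:C \/ sphere r z /\ `|f_ a b t0 z| <= eta0%:C ->
  f_ a b t1 (transport t0 t1 z) = f_ a b t0 z.
Proof.
move=> t01 t11 zr fz.
have e0 := ltW heta0.
have fE t w : f_ a b t w = deformation a b (tz t w).
  by rewrite /deformation tcoord_tz zcoord_tz.
have Kz : region (tz t0 z).
  split; [by rewrite tcoord_tz|by rewrite (depth_tz t0 0); apply/ballP|].
  case: fz; rewrite fE; first by move=> /(normC_eq _ e0); left.
  by move=> [/sphereP sz]; rewrite normC_le// (depth_tz t0 0); right.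
have Kst x y : region x -> 0 <= tcoord y <= 1 -> 0 <= depth r y ->
    (depth r y == 0) = (depth r x == 0) -> F1 y = F1 x -> F2 y = F2 x -> region y.
  move=> [_ _ Kx] ty dy dyx e1 e2; split=> //; rewrite e1 e2.
  by case: Kx => [|[/eqP h1 h2]]; [left|right; split=> //; apply/eqP; rewrite dyx].
have Kdep x : region x -> 0 <= depth r x by case.
have := flow_conserves cF1 cF2 del0 fPhi Kdep Kden Kst (s := t1 - t0) Kz.
rewrite tcoord_tz addrC subrK => /(_ t01 t11); rewrite transport_tz => -[h1 h2].
by rewrite !fE; exact: complexP.
Qed.

Lemma Cinf_zcoord_flow (V : normedModType R) (A B : V -> R * state) :
  continuous A -> (forall (y v : V) (h : R), A (h *: v + y) = h *: B v + A y) ->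
  Cinf (fun y : V => zcoord (Phi (A y).1 (A y).2) : cspace R n).
Proof.
move=> cA AB k; apply: Ck_rV => j; under eq_fun do rewrite mxE.
apply: (Ck_affine (g := fun p : R * state => Phi p.1 p.2 ord0 (rshift 1 j)) cA AB).
by apply: Ck_coord; exact: (flow_Cinf (Cinf_field r cF1 cF2 del0) fPhi).
Qed.

Lemma Ck0_tz (V : normedModType R) (t : R) (g : V -> cspace R n) :
  Ck 0 g -> Ck 0 (fun y : V => tz t (g y)).
Proof.
by move=> cg; apply: (@Ck_row_mx _ _ 0) => [y|//]; exact: cvg_cst.
Qed.

Lemma Cinf_transport t0 t1 : Cinf (transport t0 t1).
Proof.
apply: (@Cinf_zcoord_flow _ (fun z => (t1 - t0, tz t0 z)) (fun z => (0, tz 0 z))).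
  have c1 : Ck 0 (fun _ : cspace R n => t1 - t0) by exact: Ck_cst.
  have c2 : Ck 0 (fun z : cspace R n => tz t0 z).
    by apply: Ck0_tz; exact: Ck_id.
  by move=> x; exact: cvg_pair (c1 x) (c2 x).
move=> x v h; rewrite -[RHS]/(h *: 0 + (t1 - t0), h *: tz 0 v + tz t0 x).
rewrite scaler0 add0r /tz scale_row_mx add_row_mx; congr (_, row_mx _ _).
by apply/rowP => i; rewrite !mxE mulr0 add0r.
Qed.

Lemma Cinf_transport_joint :
  Cinf (fun p : R * cspace R n => transport 0 p.1 p.2).
Proof.
have -> : (fun p : R * cspace R n => transport 0 p.1 p.2) =
    (fun p => zcoord (Phi (p.1, tz 0 p.2).1 (p.1, tz 0 p.2).2)).
  by apply/funext => p; rewrite /transport subr0.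
apply: (@Cinf_zcoord_flow _ (fun p : R * cspace R n => (p.1, tz 0 p.2))
  (fun p => (p.1, tz 0 p.2))).
  have c1 : Ck 0 (fun p : R * cspace R n => p.1) by move=> x; exact: cvg_fst.
  have c2 : Ck 0 (fun p : R * cspace R n => tz 0 p.2).
    by apply: Ck0_tz => x; exact: cvg_snd.
  by move=> x; exact: cvg_pair (c1 x) (c2 x).
move=> [t z] [u w] h; rewrite -[RHS]/(h *: u + t, h *: tz 0 w + tz 0 z).
rewrite /tz scale_row_mx add_row_mx; congr (_, row_mx _ _).
by apply/rowP => i; rewrite !mxE mulr0 add0r.
Qed.

End Transversality.

Lemma Cinf_smooth_on (R : realType) (V W : normedModType R) (A : set V) (f : V -> W) :
  Cinf f -> smooth_on A f.
Proof.
move=> cf x _; exists setT, f; split=> //; first exact: openT.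
exact: Cinf_smooth.
Qed.

Theorem theorem4 (R : realType) (n : nat) (a b : 'I_n -> nat) (r eta0 : R)
    (hn : (0 < n)%N) (ha : forall j, (0 < a j)%N)
    (hr : 0 < r) (heta0 : 0 < eta0)
    (htrans : forall (t : R) (eta : R[i]), 0 <= t <= 1 -> `|eta| <= eta0%:C ->
       transverse (fiber a b t eta) (@sphere R n r)) :
  (exists h : R -> cspace R n -> cspace R n,
     [/\ isotopy (@sphere R n r) h,
         (forall z, sphere r z -> h 0 z = z),
         (forall (t : R) z, 0 <= t <= 1 -> sphere r z ->
            `|f_ a b 0 z| <= eta0%:C -> f_ a b t (h t z) = f_ a b 0 z) &
         (forall t : R, 0 <= t <= 1 -> h t @` link a b r 0 = link a b r t)]) /\
  (forall t : R, 0 <= t <= 1 ->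
     Cinfty_equivalent (tube a b eta0 r 0) (tube a b eta0 r t) (circle eta0)
       (f_ a b 0) (f_ a b t)).
Proof.
have [del del0 Kden] := region_den ha hr heta0 htrans.
have [Phi fPhi] := field_flow r (@Cinf_reF R n a b) (@Cinf_imF R n a b) del0.
pose T := transport Phi.
have TK t0 t1 z : T t1 t0 (T t0 t1 z) = z by exact: transportK del0 fPhi _ _ _.
have TS t0 t1 z : sphere r z -> sphere r (T t0 t1 z).
  exact: transport_sphere del0 fPhi _ _ _.
have TB t0 t1 z : enorm z <= r -> enorm (T t0 t1 z) <= r.
  exact: transport_ball del0 fPhi _ _ _.
have TV t0 t1 z := transport_value hr heta0 del0 Kden fPhi (t0 := t0) (t1 := t1) (z := z).
have TC t0 t1 := Cinf_transport del0 fPhi t0 t1.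
have zero01 : 0 <= (0 : R) <= 1 by rewrite lexx ler01.
have SB z : sphere r z -> enorm z <= r by rewrite /sphere /= => ->.
have norm0 : `|0 : R[i]| <= eta0%:C by rewrite normr0 lecR ltW.
split.
  exists (T 0); split.
  - split=> [t t01|]; last exact/Cinf_smooth_on/(Cinf_transport_joint del0 fPhi).
    exists (T t 0); split=> //; try by move=> z; exact: TS.
    by split; exact: Cinf_smooth_on.
  - by move=> z sz; rewrite /T /transport subrr fPhi.1 zcoord_tz.
  - by move=> t z t01 sz fz; apply: TV => //; [exact: SB|right].
  - move=> t t01; apply/seteqP; split=> [_ [z [f0 sz] <-]|w [fw sw]].
      split; last exact: TS.
      rewrite /fiber /= TV//; [exact: SB|right; split=> //].
      by rewrite f0.
    exists (T t 0 w); last exact: TK.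
    split; last exact: TS.
    rewrite /fiber /= TV//; [exact: SB|right; split=> //].
    by rewrite fw.
move=> t t01; split.
- by move=> z [].
- by move=> z [].
exists (T 0 t); split; last by move=> z [fz zr]; apply: TV => //; left.
exists (T t 0); split=> //.
- move=> z [fz zr]; split; last exact: TB.
  by rewrite TV//; left.
- move=> z [fz zr]; split; last exact: TB.
  by rewrite TV//; left.
- by split; exact: Cinf_smooth_on.
Qed.
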